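(* (1) For every $k\ge0$, $\operatorname{Im}\mathfrak d_k=\ker\mathfrak d_{k+1}$, and it is irreducible and isomorphic to $L(\omega_{k+1})$. (2) For every $k\ge1$, $\mathcal V(\omega_k)$ has exactly two composition factors, each with multiplicity one: $L(\omega_k)$ (the submodule $\operatorname{Im}\mathfrak d_{k-1}$) and $L(\omega_{k+1})$ (the quotient $\mathcal V(\omega_k)/\operatorname{Im}\mathfrak d_{k-1}\cong\operatorname{Im}\mathfrak d_k$).
   Context: $\mathbb F$ algebraically closed of characteristic $0$, $m,n\ge1$. $\mathcal R=\mathbb F[x_1,\dots,x_m]\otimes\Lambda(y_1,\dots,y_n)$ ($x_i$ even, $y_s$ odd). $\mathfrak g=W(m,n)$ the Lie superalgebra of superderivations of $\mathcal R$, free over $\mathcal R$ on even $\partial_i$ and odd $D_t$, with $\mathfrak g_0\cong\mathfrak{gl}(m|n)$ via $x_i\partial_j\mapsto E_{ij}$, $x_iD_s\mapsto E_{i,m+s}$, $y_r\partial_j\mapsto E_{m+r,j}$, $y_rD_s\mapsto E_{m+r,m+s}$. For dominant integral $\lambda$, $L^0(\lambda)$ is the irreducible finite-dimensional $\mathfrak g_0$-module of highest weight $\lambda$, $\mathcal V(\lambda)=\mathcal R\otimes L^0(\lambda)$ the mixed-product module (action for homogeneous $f,g$, $\xi$ the $\mathfrak g_0$-action: $f\partial_i.(g\otimes v)=f\partial_i(g)\otimes v+\sum_j\partial_j(f)g\otimes\xi(x_j\partial_i)v+(-1)^{\wp(f)+\wp(g)+1}\sum_jD_j(f)g\otimes\xi(y_j\partial_i)v$,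 $fD_i.(g\otimes v)=fD_i(g)\otimes v+(-1)^{\wp(g)}\sum_j\partial_j(f)g\otimes\xi(x_jD_i)v+(-1)^{\wp(f)+1}\sum_jD_j(f)g\otimes\xi(y_jD_i)v$), and $L(\lambda)$ the unique simple submodule $U(\mathfrak g)(1\otimes L^0(\lambda))$ of $\mathcal V(\lambda)$. $\omega_k=\epsilon_1+\dots+\epsilon_k$ for $k\le m$, $\omega_k=\epsilon_1+\dots+\epsilon_m+(k-m)\delta_1$ for $k\ge m$, with $L^0(\omega_k)$ realized as the $k$-th super-Grassmann power $\Omega^k(V)$ of the natural module $V=\mathbb F^{m|n}$ (basis $e_i$, even iff $i\le m$, product $\curlywedge$). $\mathfrak d_k:\mathcal V(\omega_k)\to\mathcal V(\omega_{k+1})$ is the module map $\mathfrak d_k(x^\alpha y_\eta\otimes w)=\sum_{i=1}^m\partial_i(x^\alpha)y_\eta\otimes(w\curlywedge e_i)+(-1)^{\wp(w)+|\eta|+1}\sum_{i=1}^nx^\alpha D_i(y_\eta)\otimes(w\curlywedge e_{m+i})$ for basis monomials $w$ of $\Omega^k(V)$. *)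

(* Defs.v *)
From HB Require Import structures.
From mathcomp Require Import all_boot all_order all_algebra.
From mathcomp Require Import finmap.
From mathcomp.multinomials Require Import monalg.
Import GRing.Theory.
Local Open Scope ring_scope.

(* Conventions (0-based indices):                                            *)
(*  - even variables x_0..x_{m-1}, odd variables y_0..y_{n-1};               *)
(*  - a monomial x^alpha y_eta of R is a key (alpha, eta) : Rkey, with       *)
(*    y_eta = product of the y_s, s in eta, in increasing order;             *)
(*  - V = F^{m|n} has basis e_a, a : 'I_(m+n), e_a even iff a < m;           *)
(*  - the super-Grassmann algebra Omega(V) has product (curlywedge) with     *)
(*    e_a ^ e_b = - (-1)^{p(a)p(b)} e_b ^ e_a ; its basis monomials are      *)
(*    indexed by multiplicity functions kappa : 'I_(m+n) -> nat with         *)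
(*    kappa a <= 1 for even a; the monomial is e_{a_1}^...^e_{a_k} with      *)
(*    a_1 <= ... <= a_k (a word listing a with multiplicity kappa a);        *)
(*  - gl(m|n) acts on Omega(V) by superderivations extending E_ab e_c =     *)
(*    delta_bc e_a.                                                          *)
(*  The space R (x) Omega(V) = (+)_k V(omega_k) is the F-vector space       *)
(*  M with basis Key = Rkey * Okey.                                          *)

Section WmnModules.
Variables (F : fieldType) (m n : nat).

Definition Rkey := ({ffun 'I_m -> nat} * {set 'I_n})%type.
Definition Okey := {ffun 'I_(m + n) -> nat}.
Definition Key := (Rkey * Okey)%type.
Definition M := {malg F[Key]}.

Definition sgn (b : bool) : F := (-1) ^+ b.

Definition oddi (a : 'I_(m + n)) : bool := (m <= a)%N.
Definition evI (i : 'I_m) : 'I_(m + n) := lshift n i.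
Definition odI (j : 'I_n) : 'I_(m + n) := rshift m j.

Definition eps (c d : 'I_(m + n)) : F := - sgn (oddi c && oddi d).
(* sign of sorting a word into canonical (increasing) order *)
Fixpoint osign (w : seq 'I_(m + n)) : F :=
  if w is c :: w' then (\prod_(d <- w' | (d < c)%N) eps c d) * osign w' else 1.
Definition okvalid (k : Okey) : bool := [forall a, ~~ oddi a ==> (k a <= 1)%N].
Definition ovalid (w : seq 'I_(m + n)) : bool :=
  [forall a, ~~ oddi a ==> (count_mem a w <= 1)%N].
Definition okey (w : seq 'I_(m + n)) : Okey := [ffun a => count_mem a w].
Definition oword (k : Okey) : seq 'I_(m + n) :=
  flatten [seq nseq (k a) a | a <- enum 'I_(m + n)].
Definition odeg (k : Okey) : nat := (\sum_a k a)%N.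
Definition opar (k : Okey) : bool := odd (count oddi (oword k)).

(* (c x^alpha y_eta) (x) (the word w of Omega(V), normalised) *)
Definition ovecR (c : F) (r : Rkey) (w : seq 'I_(m + n)) : M :=
  if ovalid w then << c * osign w *g (r, okey w) >> else 0.

(* ---- the superalgebra R on monomials: (coefficient, monomial) ---- *)
Fixpoint ysign (w : seq 'I_n) : F :=
  if w is c :: w' then sgn (odd (count (fun d : 'I_n => (d < c)%N) w')) * ysign w'
  else 1.
Definition rmul (a b : Rkey) : F * Rkey :=
  (if uniq (enum a.2 ++ enum b.2) then ysign (enum a.2 ++ enum b.2) else 0,
   ([ffun i => (a.1 i + b.1 i)%N], a.2 :|: b.2)).
Definition rpar (a : Rkey) : bool := odd #|a.2|.
Definition dx (i : 'I_m) (a : Rkey) : F * Rkey :=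
  ((a.1 i)%:R, ([ffun j => (a.1 j - (j == i))%N], a.2)).
Definition dy (t : 'I_n) (a : Rkey) : F * Rkey :=
  (if t \in a.2 then sgn (odd #|[set s in a.2 | (s < t)%N]|) else 0,
   (a.1, a.2 :\ t)).

(* c r (x) xi(E_{ab}) w_k  (superderivation action of E_ab) *)
Definition xiE (a b : 'I_(m + n)) (c : F) (r : Rkey) (k : Okey) : M :=
  let w := oword k in
  \sum_(p < size w | nth a w p == b)
     ovecR (c * sgn ((oddi a (+) oddi b) && odd (count oddi (take p w))))
           r (set_nth a w p a).

Definition lin (T : Key -> M) (v : M) : M := \sum_(k <- msupp v) v@_k *: T k.

(* action of f partial_i  (f = x^alpha y_eta) on the basis vector g (x) w_k *)
Definition act_d (f : Rkey) (i : 'I_m) (key : Key) : M :=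
  let g := key.1 in let k := key.2 in
  let dg := dx i g in let p := rmul f dg.2 in
  << dg.1 * p.1 *g (p.2, k) >>
  + \sum_(j < m) (let df := dx j f in let q := rmul df.2 g in
                  xiE (evI j) (evI i) (df.1 * q.1) q.2 k)
  + sgn (~~ (rpar f (+) rpar g)) *:
    \sum_(j < n) (let df := dy j f in let q := rmul df.2 g in
                  xiE (odI j) (evI i) (df.1 * q.1) q.2 k).

(* action of f D_i on the basis vector g (x) w_k *)
Definition act_D (f : Rkey) (i : 'I_n) (key : Key) : M :=
  let g := key.1 in let k := key.2 in
  let dg := dy i g in let p := rmul f dg.2 in
  << dg.1 * p.1 *g (p.2, k) >>
  + sgn (rpar g) *:
    \sum_(j < m) (let df := dx j f in let q := rmul df.2 g in
                  xiE (evI j) (odI i) (df.1 * q.1) q.2 k)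
  + sgn (~~ rpar f) *:
    \sum_(j < n) (let df := dy j f in let q := rmul df.2 g in
                  xiE (odI j) (odI i) (df.1 * q.1) q.2 k).

(* The F-basis {x^alpha y_eta partial_i, x^alpha y_eta D_t} of W(m,n). *)
Inductive Wbasis : Type :=
  | Wd of Rkey & 'I_m
  | WD of Rkey & 'I_n.

Definition act (X : Wbasis) : M -> M :=
  lin (match X with Wd f i => act_d f i | WD f i => act_D f i end).

(* the differential d (on all degrees at once; d_k is its restriction) *)
Definition dkey (key : Key) : M :=
  let g := key.1 in let w := oword key.2 in
  \sum_(i < m) (let c := dx i g in ovecR c.1 c.2 (rcons w (evI i)))
  + sgn (~~ (opar key.2 (+) rpar g)) *:
    \sum_(i < n) (let c := dy i g in ovecR c.1 c.2 (rcons w (odI i))).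
Definition dmap : M -> M := lin dkey.

(* V(omega_k) = R (x) Omega^k(V) *)
Definition Vmod (k : nat) (v : M) : Prop :=
  forall key, key \in msupp v -> okvalid key.2 /\ odeg key.2 = k.

Definition is_subspace (S : M -> Prop) : Prop :=
  S 0 /\ (forall u v, S u -> S v -> S (u + v)) /\ (forall c v, S v -> S (c *: v)).

(* W(m,n)-submodule: subspace stable under the action of W(m,n)
   (equivalently of its spanning set Wbasis) *)
Definition is_submod (S : M -> Prop) : Prop :=
  is_subspace S /\ (forall X v, S v -> S (act X v)).

Definition simple_submod (S : M -> Prop) : Prop :=
  is_submod S /\ (exists v, S v /\ v <> 0) /\
  (forall T, is_submod T -> (forall v, T v -> S v) ->
     (forall v, T v -> v = 0) \/ (forall v, S v -> T v)).

Definition is_modhom (S T : M -> Prop) (phi : M -> M) : Prop :=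
  (forall u v, S u -> S v -> phi (u + v) = phi u + phi v) /\
  (forall c v, S v -> phi (c *: v) = c *: phi v) /\
  (forall v, S v -> T (phi v)) /\
  (forall X v, S v -> phi (act X v) = act X (phi v)).

Definition mod_iso (S T : M -> Prop) : Prop :=
  exists phi, is_modhom S T phi /\
    (forall u v, S u -> S v -> phi u = phi v -> u = v) /\
    (forall w, T w -> exists v, S v /\ phi v = w).

(* L(omega_k) = U(g)(1 (x) L^0(omega_k)), the smallest submodule containing
   1 (x) Omega^k(V) *)
Definition r1 : Rkey := ([ffun => 0%N], set0).
Definition Lmod (k : nat) (v : M) : Prop :=
  forall S, is_submod S ->
    (forall kap : Okey, okvalid kap -> odeg kap = k -> S << (r1, kap) >>) -> S v.

Definition Imd (k : nat) (v : M) : Prop := exists u, Vmod k u /\ v = dmap u.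
Definition Kerd (k : nat) (v : M) : Prop := Vmod k v /\ dmap v = 0.

End WmnModules.

(* Main.v *)
Require Import Defs.
From HB Require Import structures.
From mathcomp Require Import all_boot all_order all_algebra.
From mathcomp Require Import finmap ring.
From mathcomp.multinomials Require Import monalg.
From Stdlib Require Import Classical.
Import GRing.Theory.
Local Open Scope ring_scope.

Set Implicit Arguments.
Unset Strict Implicit.
Unset Printing Implicit Defensive.

(** The action of W(m,n) on R (x) Omega(V) is a Lie derivative: with the right
    contraction A_b on Omega(V) and a suitable sign, i_X (g (x) w) = +- f g (x) A_b w
    for X = f P_b (where P_b is d/dx_b or D_b), Cartan's formula act X = d i_X + i_X d
    holds.  Together with d^2 = 0 this makes d equivariant.  Summing it over the Euler
    field, which acts on a monomial as its total degree, gives a contracting homotopy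
    in positive degree (characteristic 0), hence exactness.  Applied to a constant
    1 (x) (w e_s) with s odd it reads f D_s (1 (x) w e_s) = +- (c + 1) d (f (x) w), c
    the multiplicity of e_s in w, so Im d_k is generated by 1 (x) Omega^(k+1) and equals
    L(omega_(k+1)).  Simplicity: derivations bring any nonzero vector to a nonzero
    constant, the E_{s,a} bring that to a multiple of e_s^k, and the E_{a,s} produce
    every monomial from e_s^k.  *)

(** * Linear extension of maps given on basis monomials *)

Section Linear.
Variables (F : fieldType) (m n : nat).
Implicit Types (T : Key m n -> M F m n) (u v : M F m n).

(** Even and odd directions share one index [a] in ['I_(m + n)], so that the differential, the
    contractions and the action are all assembled from [pd], [rmul], [wedge] and [contr]; each sign
    then depends on a few parities and is settled by enumerating them. Cartan's formula already
    holds summand by summand: the super Leibniz rule meets A_b(w e_a) = delta_ab w + eps_ab (A_b w)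
    e_a, the mixed terms cancel, and what survives is the transport term and the gl(m|n) term. Since
    the action is defined by substituting letters in words, the laborious point is that E_ab is, up
    to a sign, A_b followed by right multiplication by e_a. An odd e_s is the pivot because its
    powers never vanish, so Omega^k(V) is nonzero for every k. The quotient V(omega_k) / Im d_(k-1)
    is never formed: by exactness d carries it isomorphically onto Im d_k, and its simplicity is
    that of the next image. *)

Lemma lin_dom T v (D : {fset Key m n}) :
  (msupp v `<=` D)%fset -> lin F m n T v = \sum_(k <- D) v@_k *: T k.
Proof.
move=> vD; rewrite /lin; apply: big_fset_incl => // k _ kv.
by rewrite (mcoeff_outdom kv) scale0r.
Qed.

Lemma linD T u v : lin F m n T (u + v) = lin F m n T u + lin F m n T v.
Proof.
rewrite (lin_dom T (msuppD_le u v)) (lin_dom T (fsubsetUl (msupp u) (msupp v))).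
rewrite (lin_dom T (fsubsetUr (msupp u) (msupp v))) -big_split /=.
by apply: eq_bigr => k _; rewrite mcoeffD scalerDl.
Qed.

Lemma linZ T (c : F) v : lin F m n T (c *: v) = c *: lin F m n T v.
Proof.
rewrite (lin_dom T (msuppZ_le c v)) scaler_sumr.
by apply: eq_bigr => k _; rewrite mcoeffZ scalerA.
Qed.

HB.instance Definition _ T := GRing.isLinear.Build F (M F m n) (M F m n) _
  (lin F m n T) (fun c u v => etrans (linD T (c *: u) v) (congr1 (+%R^~ _) (linZ T c u))).

Lemma malgUZ (c : F) (k : Key m n) : << c *g k >> = c *: << k >> :> M F m n.
Proof. by apply/malgP => l; rewrite mcoeffU mcoeffZ mcoeffU; case: eqP => _; rewrite ?mulr1 ?mulr0. Qed.

Lemma malgUZE (c d : F) (k : Key m n) : c *: << d *g k >> = << c * d *g k >> :> M F m n.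
Proof. by rewrite malgUZ scalerA -malgUZ. Qed.

Lemma linU T (c : F) k : lin F m n T << c *g k >> = c *: T k.
Proof. by rewrite (lin_dom T msuppU_le) big_seq_fset1 mcoeffUU. Qed.

Lemma lin_coefE T v l : (lin F m n T v)@_l = \sum_(k <- msupp v) v@_k * (T k)@_l.
Proof. by rewrite /lin raddf_sum; apply: eq_bigr => k _ /=; rewrite mcoeffZ. Qed.


Section Monomial.
Variables (c : Key m n -> F) (phi : Key m n -> Key m n).
Hypothesis phi_inj : forall k l, c k != 0 -> c l != 0 -> phi k = phi l -> k = l.

(** No cancellation can occur: by injectivity, only [k] itself contributes to the coefficient at
    [phi k]. This is how images of nonzero vectors are later seen to be nonzero. *)
Lemma mcoeff_lin_monomial v k : c k != 0 ->
  (lin F m n (fun k => << c k *g phi k >>) v)@_(phi k) = v@_k * c k.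
Proof.
move=> ck; rewrite lin_coefE.
have [kv|kv] := boolP (k \in msupp v); last first.
  rewrite (mcoeff_outdom kv) mul0r big_seq big1 // => l lv.
  rewrite mcoeffU; case: eqP => [E|_]; last by rewrite mulr0.
  have [->|cl] := eqVneq (c l) 0; first by rewrite mulr0.
  by move: lv; rewrite (phi_inj cl ck E) (negbTE kv).
rewrite (big_fsetD1 k kv) /= mcoeffUU big1_fset ?addr0 // => l.
rewrite in_fsetD1 => /andP[lk _] _; rewrite mcoeffU.
case: eqP => [E|_]; last by rewrite mulr0.
have [->|cl] := eqVneq (c l) 0; first by rewrite mulr0.
by rewrite (phi_inj cl ck E) eqxx in lk.
Qed.
End Monomial.

Lemma msupp_sum_mem (I : Type) (r : seq I) (P : pred I) (G : I -> M F m n) k :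
  k \in msupp (\sum_(i <- r | P i) G i) -> exists2 i, P i & k \in msupp (G i).
Proof.
elim: r => [|i r IH]; first by rewrite big_nil msupp0 in_fset0.
rewrite big_cons; case: ifP => [Pi|_]; last exact: IH.
move/(fsubsetP (msuppD_le _ _)); rewrite in_fsetU => /orP[ki|/IH//].
by exists i.
Qed.

Lemma msupp_lin_mem T v k : k \in msupp (lin F m n T v) ->
  exists2 l, l \in msupp v & k \in msupp (T l).
Proof.
rewrite /lin big_seq => /msupp_sum_mem[l lv kl]; exists l => //.
exact: (fsubsetP (msuppZ_le _ _)) kl.
Qed.

Lemma msuppU_mem (c : F) (k l : Key m n) :
  k \in msupp (<< c *g l >> : M F m n) -> c != 0 /\ k = l.
Proof.
by rewrite msuppU; case: eqP => //= _; rewrite in_fset1 => /eqP.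
Qed.

End Linear.

(** * Signs as characters of parities *)

Section Signs.
Variable F : fieldType.

Lemma sgnD b c : sgn F (b (+) c) = sgn F b * sgn F c.
Proof. by rewrite /sgn signr_addb. Qed.

Lemma sgnN b : sgn F (~~ b) = - sgn F b.
Proof. by rewrite /sgn signrN. Qed.

Lemma sgn_odd k : sgn F (odd k) = (-1) ^+ k.
Proof. by rewrite /sgn signr_odd. Qed.

Lemma sgn_sq b : sgn F b * sgn F b = 1.
Proof. by rewrite -sgnD addbb. Qed.

Lemma sgn_neq0 b : sgn F b != 0.
Proof. by rewrite /sgn signr_eq0. Qed.

End Signs.

(** * The superalgebra of polynomials: products, derivations and their signs *)

Section PolynomialSuperalgebra.
Variables (F : fieldType) (m n : nat).
Local Notation R := (Rkey m n).
Local Notation I := 'I_(m + n).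
Local Notation odd_ := (@oddi m n).
Implicit Types (r f g : R) (a b : I) (A B : {set 'I_n}) (s t x y : 'I_n).

Lemma oddi_evI i : odd_ (evI m n i) = false.
Proof. by rewrite /oddi /= leqNgt ltn_ord. Qed.

Lemma oddi_odI j : odd_ (odI m n j) = true.
Proof. by rewrite /oddi leq_addr. Qed.

Lemma split_evI i : split (evI m n i) = inl i.
Proof. exact: (unsplitK (inl i)). Qed.

Lemma split_odI j : split (odI m n j) = inr j.
Proof. exact: (unsplitK (inr j)). Qed.

Lemma index_ind (P : I -> Prop) :
  (forall i, P (evI m n i)) -> (forall j, P (odI m n j)) -> forall a, P a.
Proof. by move=> Pe Po a; case: (split_ordP a) => [i ->|j ->]. Qed.

(** When the coefficient is zero, the monomial component carries no meaning: exponents are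
    subtracted with truncation. *)
Definition pd a r : F * R :=
  match split a with inl i => dx F m n i r | inr j => dy F m n j r end.

Lemma pd_evI i r : pd (evI m n i) r = dx F m n i r.
Proof. by rewrite /pd split_evI. Qed.

Lemma pd_odI j r : pd (odI m n j) r = dy F m n j r.
Proof. by rewrite /pd split_odI. Qed.

Definition var a : R :=
  match split a with
  | inl i => ([ffun j => (j == i) : nat], set0)
  | inr j => ([ffun => 0%N], [set j])
  end.

(** Composition of operators that send a monomial to a scalar times a monomial; the scalars
    multiply. *)
Definition bind (T U : Type) (p : F * T) (G : T -> F * U) : F * U :=
  (p.1 * (G p.2).1, (G p.2).2).

Definition inv_sign x y : F := sgn F (y < x)%N.
Definition mul_sign A B : F := \prod_(x in A) \prod_(y in B) inv_sign x y.

Lemma inv_signC x y : x != y -> inv_sign x y = - inv_sign y x.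
Proof.
by move=> xy; rewrite /inv_sign -sgnN -leqNgt (leq_eqVlt y x) val_eqE eq_sym (negbTE xy).
Qed.

Lemma inv_sign_sq x y : inv_sign x y * inv_sign x y = 1.
Proof. exact: sgn_sq. Qed.

Lemma inv_signxx x : inv_sign x x = 1.
Proof. by rewrite /inv_sign ltnn. Qed.

Lemma prod_sgn (T : Type) (l : seq T) (P p : pred T) :
  \prod_(x <- l | P x) sgn F (p x) = sgn F (odd (count (predI P p) l)).
Proof.
elim: l => [|c l IH]; first by rewrite big_nil.
rewrite big_cons /= oddD sgnD -IH; case: (P c) => //=; last by rewrite mul1r.
by case: (p c).
Qed.

Lemma prod_sgn_set (A : {set 'I_n}) (p : pred 'I_n) :
  \prod_(x in A) sgn F (p x) = sgn F (odd #|[set x in A | p x]|).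
Proof.
by rewrite prod_sgn cardE /enum_mem -size_filter; congr (sgn _ (odd (size _)));
  apply: eq_filter => x; rewrite !inE.
Qed.

Lemma dyE t r : dy F m n t r =
  ((t \in r.2)%:R * \prod_(x in r.2) inv_sign t x, (r.1, r.2 :\ t)).
Proof. by rewrite /dy prod_sgn_set; case: ifP; rewrite ?mul1r ?mul0r. Qed.

Lemma ysign_cat u w : ysign F n (u ++ w) =
  ysign F n u * (\prod_(x <- u) \prod_(y <- w) inv_sign x y) * ysign F n w.
Proof.
elim: u => [|c u IH]; first by rewrite big_nil !mul1r.
rewrite big_cons /= IH count_cat oddD sgnD prod_sgn.
rewrite (_ : count (predI _ _) w = count (fun d : 'I_n => (d < c)%N) w) //.
ring.
Qed.

Lemma ysign_enum A : ysign F n (enum A) = 1.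
Proof.
have : sorted (fun x y : 'I_n => (x < y)%N) (enum A).
  rewrite /enum_mem; apply: sorted_filter; first by move=> ? ? ?; apply: ltn_trans.
  by rewrite -enumT; have := iota_ltn_sorted 0 n; rewrite -val_enum_ord sorted_map.
elim: (enum A) => //= c w IH pw; rewrite IH ?(path_sorted pw) // mulr1.
have /allP cw : all (fun y : 'I_n => (c < y)%N) w.
  by apply: (order_path_min _ pw) => ? ? ?; apply: ltn_trans.
rewrite (_ : count _ w = 0)%N //; apply/eqP; rewrite -leqn0 leqNgt -has_count.
by apply/hasPn => y /cw; rewrite -leqNgt => /ltnW.
Qed.

(** Both enumerations are increasing, so the sign of sorting their concatenation comes only from the
    inversions between the two sets. *)
Lemma rmulE f g : rmul F m n f g =
  ([disjoint f.2 & g.2]%:R * mul_sign f.2 g.2,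
   ([ffun i => (f.1 i + g.1 i)%N], f.2 :|: g.2)).
Proof.
rewrite /rmul cat_uniq !enum_uniq /= andbT ysign_cat !ysign_enum mul1r mulr1.
rewrite (_ : ~~ has _ _ = [disjoint f.2 & g.2]).
  rewrite /mul_sign big_enum /=; congr (_, _).
  under [X in if _ then X else _]eq_bigr do rewrite big_enum.
  by case: ifP; rewrite ?mul1r ?mul0r.
apply/hasPn/pred0P => H x /=.
  apply/negP => /andP[xf xg]; have := H x; rewrite !mem_enum => /(_ xg).
  by rewrite xf.
by rewrite !mem_enum => xg; have := H x; rewrite /= xg andbT => ->.
Qed.

Lemma mul_signD1l t A B : t \in A ->
  mul_sign A B = (\prod_(y in B) inv_sign t y) * mul_sign (A :\ t) B.
Proof. by move=> tA; rewrite /mul_sign (big_setD1 t). Qed.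

Lemma mul_signD1r t A B : t \in B ->
  mul_sign A B = (\prod_(x in A) inv_sign x t) * mul_sign A (B :\ t).
Proof.
by move=> tA; rewrite /mul_sign -big_split; apply: eq_bigr => x _; rewrite (big_setD1 t).
Qed.

(** For each [x] in [A] other than [t], exactly one of the pairs (x, t) and (t, x) is an
    inversion. *)
Lemma prod_inv_sign_set t A :
  (\prod_(x in A) inv_sign x t) * (\prod_(x in A) inv_sign t x) =
  sgn F (odd #|A| (+) (t \in A)).
Proof.
have H B : t \notin B -> (\prod_(x in B) inv_sign x t) *
    (\prod_(x in B) inv_sign t x) = sgn F (odd #|B|).
  move=> tB; rewrite -big_split sgn_odd -prodr_const; apply: eq_bigr => x xB /=.
  rewrite (@inv_signC x t) ?mulNr ?inv_sign_sq //.
  by apply: contraNneq tB => <-.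
have [tA|tA] := boolP (t \in A); last by rewrite addbF H.
rewrite !(big_setD1 t tA) /= inv_signxx !mul1r H ?setD11 //.
by rewrite (cardsD1 t A) tA add1n /= addbT negbK.
Qed.

Lemma sgn_prod_sq (J : finType) (P : pred J) (p : J -> bool) :
  (\prod_(x | P x) sgn F (p x)) * (\prod_(x | P x) sgn F (p x)) = 1.
Proof. by rewrite -big_split big1 // => x _ /=; rewrite sgn_sq. Qed.

Lemma prod_inv_sign_sq t A :
  (\prod_(x in A) inv_sign t x) * (\prod_(x in A) inv_sign t x) = 1.
Proof. exact: sgn_prod_sq. Qed.

Variables (V : lmodType F) (e : Key m n -> V).

(** Identities between scaled monomials fail as equalities of pairs when the scalar is zero. They
    are therefore stated after mapping to a module, where the monomials need to agree only if the
    scalar is nonzero. *)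
Definition tens (p : F * R) (q : F * Okey m n) : V := (p.1 * q.1) *: e (p.2, q.2).

Lemma natr_neq0_gt0 k : k%:R != 0 :> F -> (0 < k)%N.
Proof. by case: k => //; rewrite eqxx. Qed.

Lemma tens_eql p p' q : p.1 = p'.1 -> (p.1 != 0 -> p.2 = p'.2) -> tens p q = tens p' q.
Proof.
rewrite /tens => <-; have [->|_ -> //] := eqVneq p.1 0.
by rewrite mul0r !scale0r.
Qed.

Lemma tens_eqr p q q' : q.1 = q'.1 -> (q.1 != 0 -> q.2 = q'.2) -> tens p q = tens p q'.
Proof.
rewrite /tens => <-; have [->|_ -> //] := eqVneq q.1 0.
by rewrite mulr0 !scale0r.
Qed.

Lemma tens0l p q : p.1 = 0 -> tens p q = 0.
Proof. by rewrite /tens => ->; rewrite mul0r scale0r. Qed.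

Lemma tens0r p q : q.1 = 0 -> tens p q = 0.
Proof. by rewrite /tens => ->; rewrite mulr0 scale0r. Qed.

Lemma tensZl (c : F) p q : tens (c * p.1, p.2) q = c *: tens p q.
Proof. by rewrite /tens scalerA mulrA. Qed.

Lemma tensZr (c : F) p q : tens p (c * q.1, q.2) = c *: tens p q.
Proof. by rewrite /tens scalerA mulrCA. Qed.

Lemma tensDl c d r q : tens (c + d, r) q = tens (c, r) q + tens (d, r) q.
Proof. by rewrite /tens mulrDl scalerDl. Qed.

Lemma tensDr p c d k : tens p (c + d, k) = tens p (c, k) + tens p (d, k).
Proof. by rewrite /tens mulrDr scalerDl. Qed.

Lemma prod_setU (J : finType) (A B : {set J}) (h : J -> F) : [disjoint A & B] ->
  \prod_(x in A :|: B) h x = (\prod_(x in A) h x) * \prod_(x in B) h x.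
Proof. by move=> dAB; rewrite -bigU //; apply: eq_bigl => x; rewrite !inE. Qed.

Lemma disjointD1l t A B : t \notin B -> [disjoint A :\ t & B] = [disjoint A & B].
Proof.
move=> tB; rewrite -!setI_eq0; congr (_ == _); apply/setP => x; rewrite !inE.
by have [->|] := eqVneq x t; rewrite ?(negbTE tB) ?andbF.
Qed.

Lemma disjointD1r t A B : t \notin A -> [disjoint A & B :\ t] = [disjoint A & B].
Proof. by move=> tA; rewrite disjoint_sym disjointD1l // disjoint_sym. Qed.

Lemma pd_leibniz a f g q :
  tens (bind (rmul F m n f g) (pd a)) q =
    tens (bind (pd a f) (rmul F m n ^~ g)) q
    + sgn F (odd_ a && rpar m n f) *: tens (bind (pd a g) (rmul F m n f)) q.
Proof.
elim/index_ind: a => [i|t].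
  rewrite /bind !pd_evI !rmulE /dx /= oddi_evI scale1r ffunE natrD mulrDr tensDl.
  congr (_ + _); apply: tens_eql => /=; try by rewrite mulrC.
    rewrite !mulf_eq0 !negb_or.
    move=> /andP[_ fi]; congr (_, _); apply/ffunP => j; rewrite !ffunE.
    case: eqP => [->|]; rewrite ?subn0 //= addnBAC //.
    exact: natr_neq0_gt0 fi.
  rewrite !mulf_eq0 !negb_or => /andP[_ fi]; congr (_, _); apply/ffunP => j; rewrite !ffunE.
  case: eqP => [->|]; rewrite ?subn0 //= addnBA //.
  exact: natr_neq0_gt0 fi.
case: f g => [al A] [be B].
rewrite /bind !pd_odI !rmulE !dyE /= oddi_odI /rpar /= !inE.
have [tA|tA] := boolP (t \in A); have [tB|tB] := boolP (t \in B) => /=.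
(* With [t] in both sets the product on the left is zero, and the two terms on the right have the
   same monomial and opposite signs. *)
- rewrite [X in X = _]tens0l /=; last first.
    rewrite (_ : [disjoint A & B] = false) ?mul0r //.
    by apply/negP => /disjoint_setI0/setP/(_ t); rewrite !inE tA tB.
  rewrite !mul1r -(@disjointD1r t (A :\ t) B) ?setD11 // -(@disjointD1l t A (B :\ t)) ?setD11 //.
  rewrite -tensZl /=.
  rewrite [X in tens (_, (_, X))](_ : (A :\ t) :|: B = A :|: B); last first.
    by apply/setP => x; rewrite !inE; case: eqP => // ->; rewrite tB !orbT.
  rewrite [X in _ + tens (_, (_, X)) _](_ : A :|: (B :\ t) = A :|: B); last first.
    by apply/setP => x; rewrite !inE; case: eqP => // ->; rewrite tA.
  rewrite -tensDl tens0l //=.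
  rewrite (@mul_signD1r t (A :\ t)) // (@mul_signD1l t A) //.
  have -> : (\prod_(y in B) inv_sign t y) = \prod_(y in B :\ t) inv_sign t y.
    by rewrite (big_setD1 t tB) /= inv_signxx mul1r.
  have := prod_inv_sign_set t (A :\ t); rewrite setD11 addbF.
  have := prod_inv_sign_sq t (B :\ t).
  have -> : (\prod_(y in A) inv_sign t y) = \prod_(y in A :\ t) inv_sign t y.
    by rewrite (big_setD1 t tA) /= inv_signxx mul1r.
  rewrite (cardsD1 t A) tA add1n /= sgnN.
  move: (\prod_(y in B :\ t) _) (\prod_(x in A :\ t) inv_sign t x)
        (\prod_(x in A :\ t) inv_sign x t) (sgn F _) (mul_sign _ _) => b a1 a2 s mu E1 E2.
  rewrite -E2; move: (_%:R) => z.
  transitivity (a1 * z * a2 * mu * (1 - b * b)); first by ring.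
  by rewrite E1 subrr mulr0.
- rewrite [X in _ = _ + _ *: X]tens0l ?scaler0 ?addr0 /=; last by rewrite !mul0r.
  rewrite mul1r (disjointD1l _ tB); case: (boolP [disjoint A & B]) => dAB; last first.
    by rewrite !mul0r !tens0l //= ?mul0r ?mulr0.
  apply: tens_eql => /=; last first.
    move=> _; congr (_, _); apply/setP => x; rewrite !inE.
    by case: eqP => // ->; rewrite (negbTE tB).
  rewrite !mul1r (@mul_signD1l t A) // prod_setU //.
  have := prod_inv_sign_sq t B.
  move: (\prod_(y in B) _) (\prod_(x in A) _) (mul_sign _ _) => b a mu E.
  by transitivity (b * b * (a * mu)); [ring | rewrite E mul1r].
- rewrite [X in _ = X + _]tens0l ?add0r /=; last by rewrite !mul0r.
  rewrite mul1r (disjointD1r _ tA); case: (boolP [disjoint A & B]) => dAB; last first.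
    by rewrite !mul0r !tens0l ?scaler0 //= ?mul0r ?mulr0.
  rewrite -tensZl; apply: tens_eql => /=; last first.
    move=> _; congr (_, _); apply/setP => x; rewrite !inE.
    by case: eqP => // ->; rewrite (negbTE tA).
  rewrite !mul1r (@mul_signD1r t A) // prod_setU //.
  have := prod_inv_sign_set t A; rewrite (negbTE tA) addbF => <-.
  by move: (\prod_(y in B) _) (\prod_(x in A) _) (\prod_(x in A) _) (mul_sign _ _) => b a a' mu; ring.
- by rewrite !tens0l /= ?mul0r ?mulr0 ?scaler0 ?addr0.
Qed.

Lemma pdC a b r q :
  tens (bind (pd b r) (pd a)) q =
    sgn F (odd_ a && odd_ b) *: tens (bind (pd a r) (pd b)) q.
Proof.
rewrite -tensZl.
elim/index_ind: a => [i|s]; elim/index_ind: b => [j|t];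
  rewrite /bind ?(pd_evI, pd_odI) ?(oddi_evI, oddi_odI) /dx ?dyE /= ?mul1r.
- apply: tens_eql => /=; rewrite !ffunE; last first.
    by move=> _; congr (_, _); apply/ffunP => l; rewrite !ffunE subnAC.
  by rewrite eq_sym; case: eqP => [->//|_]; rewrite !subn0 mulrC.
- by apply: tens_eql => //=; rewrite mulrC.
- by apply: tens_eql => //=; rewrite mulrC.
(* For s = t both sides vanish. Otherwise the two orders differ only in the factor of the pair (s,
   t), which produces the -1. *)
- have [<-|st] := eqVneq s t; first by rewrite !tens0l //= setD11 !(mul0r, mulr0).
  apply: tens_eql => /=; last first.
    move=> _; congr (_, _); apply/setP => l; rewrite !inE.
    by case: (l == s); case: (l == t).
  rewrite !inE st eq_sym st /=.
  have [sr|] := boolP (s \in r.2); last by rewrite !(mul0r, mulr0).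
  have [tr|] := boolP (t \in r.2); last by rewrite !(mul0r, mulr0).
  rewrite !mul1r (big_setD1 s sr) [X in _ = _ * (X * _)](big_setD1 t tr) /= (inv_signC st).
  by rewrite /sgn expr1; ring.
Qed.

Lemma pd_par a r : (pd a r).1 != 0 -> rpar m n (pd a r).2 = rpar m n r (+) odd_ a.
Proof.
elim/index_ind: a => [i|t]; rewrite ?pd_evI ?pd_odI /dx ?dyE /= ?(oddi_evI, oddi_odI).
  by rewrite /rpar addbF.
case: (boolP (t \in _)) => tr; rewrite ?mul0r ?eqxx // => _.
by rewrite /rpar /= (cardsD1 t r.2) tr add1n /= addbT negbK.
Qed.

Lemma rmul_par f g : (rmul F m n f g).1 != 0 ->
  rpar m n (rmul F m n f g).2 = rpar m n f (+) rpar m n g.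
Proof.
rewrite rmulE /=; case: (boolP [disjoint _ & _]) => [d _|_]; last by rewrite mul0r eqxx.
by rewrite /rpar /= cardsU disjoint_setI0 // cards0 subn0 oddD.
Qed.

Definition rdeg r : nat := (\sum_i r.1 i + #|r.2|)%N.

Lemma pd_deg a r : (pd a r).1 != 0 -> rdeg r = (rdeg (pd a r).2).+1.
Proof.
elim/index_ind: a => [i|t]; rewrite ?pd_evI ?pd_odI /dx ?dyE /= /rdeg /=.
  move=> ri; rewrite -addSn; congr (_ + _)%N.
  rewrite (bigD1 i) //= [in RHS](bigD1 i) //= ffunE eqxx -addSn; congr (_ + _)%N.
    by move: ri; case: (r.1 i) => [|l _]; rewrite ?eqxx // subn1.
  by apply: eq_bigr => j /negbTE ji; rewrite ffunE ji subn0.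
case: (boolP (t \in _)) => tr; rewrite ?mul0r ?eqxx // => _.
by rewrite (cardsD1 t r.2) tr add1n addnS.
Qed.

(** A nonzero coefficient means that the variable was present, so it can be put back. This supplies
    the injectivity required by [mcoeff_lin_monomial]. *)
Lemma pd_inj a r r' : (pd a r).1 != 0 -> (pd a r').1 != 0 ->
  (pd a r).2 = (pd a r').2 -> r = r'.
Proof.
case: r r' => [al A] [al' A'].
elim/index_ind: a => [i|t]; rewrite ?pd_evI ?pd_odI /dx ?dyE /=.
  move=> ri ri' [/ffunP E ->]; congr (_, _); apply/ffunP => j.
  move: (E j); rewrite !ffunE; case: eqP => [->|_]; rewrite ?subn0 // !subn1.
  by case: (al i) ri => [|x]; case: (al' i) ri' => [|y]; rewrite ?eqxx //= => _ _ ->.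
case: (boolP (t \in A)) => tr; rewrite ?mul0r ?eqxx // => _.
case: (boolP (t \in A')) => tr'; rewrite ?mul0r ?eqxx // => _ [-> /setP E].
congr (_, _); apply/setP => x; move: (E x); rewrite !inE.
by case: eqP => // -> _; rewrite tr tr'.
Qed.

Definition rcount r a : nat :=
  match split a with inl i => r.1 i | inr j => j \in r.2 end.

Lemma sum_rcount r : (\sum_a rcount r a = rdeg r)%N.
Proof.
rewrite big_split_ord /rdeg; congr (_ + _)%N.
  by apply: eq_bigr => i _; rewrite /rcount split_evI.
rewrite -sum1_card [RHS]big_mkcond; apply: eq_bigr => j _.
by rewrite /rcount split_odI; case: (_ \in _).
Qed.

Lemma pd_coef_eq0 a r : [pchar F] =i pred0 -> ((pd a r).1 == 0) = (rcount r a == 0)%N.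
Proof.
move=> /pcharf0P charF; rewrite /rcount; elim/index_ind: a => [i|t].
  by rewrite pd_evI split_evI charF.
rewrite pd_odI split_odI dyE /=; case: (t \in _); last by rewrite mul0r eqxx.
by rewrite mul1r prod_sgn_set (negbTE (sgn_neq0 _ _)).
Qed.

Lemma rcount_eq0 r : (forall a, rcount r a = 0)%N -> r = r1 m n.
Proof.
case: r => [al A] H; congr (_, _).
  by apply/ffunP => i; move: (H (evI m n i)); rewrite /rcount split_evI ffunE.
apply/setP => j; move: (H (odI m n j)); rewrite /rcount split_odI inE /=.
by case: (j \in A).
Qed.

Lemma rmul1l r : rmul F m n (r1 m n) r = (1, r).
Proof.
rewrite rmulE /= /mul_sign big_set0 ?mulr1; case: r => al A /=.
rewrite set0U; congr (_, (_, _)); last by apply/ffunP => i; rewrite !ffunE.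
by rewrite -setI_eq0 set0I eqxx.
Qed.

Lemma pd_r1 a : (pd a (r1 m n)).1 = 0.
Proof.
by elim/index_ind: a => [i|t]; rewrite ?pd_evI ?pd_odI /dx ?dyE /= ?ffunE ?inE ?mul0r.
Qed.

Lemma pd_var a b : (pd a (var b)).1 = (a == b)%:R /\ (a = b -> (pd a (var b)).2 = r1 m n).
Proof.
have eo i j : evI m n i == odI m n j = false by rewrite eq_lrshift.
have oe i j : odI m n i == evI m n j = false by rewrite eq_rlshift.
have ee i j : (evI m n i == evI m n j) = (i == j) by rewrite eq_lshift.
have oo i j : (odI m n i == odI m n j) = (i == j) by rewrite eq_rshift.
elim/index_ind: a => [i|s]; elim/index_ind: b => [j|t];
  rewrite ?pd_evI ?pd_odI /dx ?dyE /= /var ?(split_evI, split_odI) /= ?ffunE.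
- rewrite ee; split=> // /eqP; rewrite ee => /eqP <-; congr (_, _).
  by apply/ffunP => l; rewrite !ffunE subnn.
- by rewrite eo; split=> // /eqP; rewrite eo.
- by rewrite oe inE mul0r; split=> // /eqP; rewrite oe.
- rewrite oo inE; split=> [|/eqP]; last first.
    by rewrite oo => /eqP <-; congr (_, _); rewrite setDv.
  by case: eqP => [->|_]; rewrite ?mul0r // mul1r big_set1 inv_signxx.
Qed.

(** One summand of the Euler field. For odd [b], multiplying by the variable undoes the sign of
    differentiating by it. *)
Lemma rmul_var_pd b r q :
  tens (bind (pd b r) (rmul F m n (var b))) q = (rcount r b)%:R *: tens (1, r) q.
Proof.
case: r => al A; rewrite -tensZl; apply: tens_eql; rewrite /bind /rcount rmulE;
elim/index_ind: b => [i|t]; rewrite ?pd_evI ?pd_odI /dx ?dyE /= /var ?(split_evI, split_odI) /=.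
- by rewrite /mul_sign big_set0 -setI_eq0 set0I eqxx !mulr1.
- rewrite -setI_eq0 setIDA (_ : _ :\ t = set0) ?eqxx; last by apply/setP => x; rewrite !inE; case: eqP.
  rewrite /mul_sign big_set1; case: (boolP (t \in A)) => tA; rewrite ?mul0r ?mul1r ?mulr1 //.
  by rewrite (big_setD1 t tA) /= inv_signxx mul1r prod_inv_sign_sq.
- move=> ali; rewrite set0U; congr (_, _); apply/ffunP => j; rewrite !ffunE.
  case: eqP => [->|_]; rewrite ?subn0 // add1n subn1.
  by case: (al i) ali => //; rewrite mul0r eqxx.
- case: (boolP (t \in A)) => tA; rewrite ?mul0r ?eqxx // => _; congr (_, _).
    by apply/ffunP => j; rewrite !ffunE.
  by apply/setP => x; rewrite !inE; case: eqP => // ->; rewrite tA.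
Qed.

Lemma rpar_var a : rpar m n (var a) = odd_ a.
Proof.
by elim/index_ind: a => [i|t]; rewrite /rpar /var ?(split_evI, split_odI)
  ?(oddi_evI, oddi_odI) /= ?cards0 ?cards1.
Qed.


End PolynomialSuperalgebra.

(** * The super-Grassmann algebra: sorted words, right multiplication and right contraction *)

Section SuperGrassmann.
Variables (F : fieldType) (m n : nat).
Local Notation R := (Rkey m n).
Local Notation O := (Okey m n).
Local Notation I := 'I_(m + n).
Local Notation odd_ := (@oddi m n).
Local Notation eps := (eps F m n).
Local Notation sgn := (sgn F).
Local Notation okey := (okey m n).
Local Notation oword := (oword m n).
Local Notation okvalid := (okvalid m n).
Local Notation opar := (opar m n).
Implicit Types (a b c d : I) (k l : O) (w pre suf : seq I).

Lemma epsC a b : eps a b = eps b a.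
Proof. by rewrite /Defs.eps andbC. Qed.

Lemma eps_sq a b : eps a b * eps a b = 1.
Proof. by rewrite /Defs.eps mulrNN sgn_sq. Qed.

Lemma eps_odd a : odd_ a -> eps a a = 1.
Proof. by rewrite /Defs.eps => ->; rewrite /Defs.sgn expr1 opprK. Qed.


Definition oadd k a : O := [ffun c => (k c + (c == a))%N].
Definition osub k a : O := [ffun c => (k c - (c == a))%N].

Lemma osubK k a : (0 < k a)%N -> oadd (osub k a) a = k.
Proof.
by move=> ka; apply/ffunP => c; rewrite !ffunE; case: eqP => [->|_]; rewrite ?subn0 ?addn0 ?subnK.
Qed.

Lemma oaddK k a : osub (oadd k a) a = k.
Proof. by apply/ffunP => c; rewrite !ffunE addnK. Qed.

Lemma oaddAC k a b : oadd (oadd k a) b = oadd (oadd k b) a.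
Proof. by apply/ffunP => c; rewrite !ffunE addnAC. Qed.

Lemma osub_add k a b : a != b -> osub (oadd k a) b = oadd (osub k b) a.
Proof.
move=> ab; apply/ffunP => c; rewrite !ffunE.
by case: (eqVneq c b) => [->|_]; rewrite ?subn0 // eq_sym (negbTE ab) !addn0.
Qed.

Lemma okvalidP k : reflect (forall a, ~~ odd_ a -> (k a <= 1)%N) (okvalid k).
Proof. by apply: (iffP forallP) => H a; have /implyP := H a. Qed.

Lemma okvalid_sub k a : okvalid k -> okvalid (osub k a).
Proof.
by move=> /okvalidP H; apply/okvalidP => c /H; rewrite ffunE; apply: leq_trans; rewrite leq_subr.
Qed.

Lemma okvalid_addW k a : okvalid (oadd k a) -> okvalid k.
Proof.
by move=> /okvalidP H; apply/okvalidP => c /H; rewrite ffunE; apply: leq_trans; rewrite leq_addr.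
Qed.

Lemma okvalid_add k a : okvalid k -> okvalid (oadd k a) = odd_ a || (k a == 0)%N.
Proof.
move=> /okvalidP H; apply/okvalidP/idP => [/(_ a)|Ha c ec].
  by rewrite ffunE eqxx addn1 ltnS leqn0; case: (odd_ a) => //= ->.
rewrite ffunE; case: eqP => [E|_]; last by rewrite addn0 H.
by move: Ha; rewrite -E (negbTE ec) /= => /eqP ->.
Qed.

Lemma count_memE (P : pred I) w : (count P w = \sum_(a | P a) count_mem a w)%N.
Proof.
elim: w => [|c w IH] /=; first by rewrite big1.
rewrite big_split /= -IH; congr (_ + _)%N.
have [Pc|nPc] := boolP (P c).
  rewrite (bigD1 c) //= eqxx big1 ?addn0 // => a /andP[_ ac].
  by rewrite eq_sym (negbTE ac).
by rewrite big1 // => a Pa; case: eqP => // E; rewrite E Pa in nPc.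
Qed.

Lemma prod_countE (P : pred I) (h : I -> F) w :
  \prod_(d <- w | P d) h d = \prod_(d | P d) h d ^+ count_mem d w.
Proof.
elim: w => [|c w IH] /=; first by rewrite big_nil big1.
under [in RHS]eq_bigr do rewrite exprD.
rewrite big_split /= -IH big_cons; have [Pc|nPc] := boolP (P c).
  congr (_ * _); rewrite (bigD1 c) //= eqxx expr1 big1 ?mulr1 // => a /andP[_ ac].
  by rewrite eq_sym (negbTE ac).
rewrite [X in _ = X * _]big1 ?mul1r // => a Pa.
by case: eqP => // E; rewrite E Pa in nPc.
Qed.

Lemma count_oword k a : count_mem a (oword k) = k a.
Proof.
rewrite /Defs.oword count_flatten -map_comp sumnE big_map big_enum /=.
rewrite (bigD1 a) //= count_nseq /= eqxx mul1n big1 ?addn0 // => c ca.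
by rewrite count_nseq /= (negbTE ca) mul0n.
Qed.

Lemma owordK k : okey (oword k) = k.
Proof. by apply/ffunP => a; rewrite ffunE count_oword. Qed.

Lemma opar_okey w : opar (okey w) = odd (count odd_ w).
Proof.
rewrite /Defs.opar !(count_memE odd_); congr (odd _); apply: eq_bigr => a _.
by rewrite count_oword ffunE.
Qed.

Lemma oparE k : opar k = odd (\sum_(a | odd_ a) k a).
Proof.
by rewrite /Defs.opar count_memE; congr (odd _); apply: eq_bigr => a _; rewrite count_oword.
Qed.

Lemma opar_add k a : opar (oadd k a) = opar k (+) odd_ a.
Proof.
rewrite !oparE; under eq_bigr do rewrite ffunE.
rewrite big_split /= oddD; congr (_ (+) _).
have [oa|oa] := boolP (odd_ a).
  by rewrite (bigD1 a) //= eqxx big1 // => c /andP[_ /negbTE->].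
by rewrite big1 // => c oc; case: eqP => // E; rewrite -E oc in oa.
Qed.

Lemma opar_sub k a : (0 < k a)%N -> opar (osub k a) = opar k (+) odd_ a.
Proof. by move=> ka; rewrite -{2}(osubK ka) opar_add addbK. Qed.

Lemma odeg_add k a : odeg m n (oadd k a) = (odeg m n k).+1.
Proof.
rewrite /odeg; under eq_bigr do rewrite ffunE.
rewrite big_split /= -addn1; congr (_ + _)%N.
by rewrite (bigD1 a) //= eqxx big1 // => c /negbTE->.
Qed.

Lemma odeg_sub k a : (0 < k a)%N -> odeg m n k = (odeg m n (osub k a)).+1.
Proof. by move=> ka; rewrite -{1}(osubK ka) odeg_add. Qed.

Let le_ := (fun x y : I => (x <= y)%N).

Lemma le_ord_trans : transitive le_.
Proof. by move=> ? ? ?; apply: leq_trans. Qed.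

Lemma oword_sorted k : sorted le_ (oword k).
Proof.
have : sorted le_ (enum 'I_(m + n)).
  by have := iota_sorted 0 (m + n); rewrite -val_enum_ord sorted_map.
rewrite /Defs.oword; elim: (enum _) => //= c w IH cw.
have {}IH := IH (path_sorted cw).
have /allP {cw}cw := order_path_min le_ord_trans cw.
elim: (k c) => //= x; rewrite path_sortedE; last exact: le_ord_trans.
move=> ->; rewrite andbT all_cat all_nseq /le_ leqnn orbT.
by apply/allP => y /flatten_mapP[z /cw cz]; rewrite mem_nseq => /andP[_ /eqP->].
Qed.

Lemma osign_sorted w : sorted le_ w -> osign F m n w = 1.
Proof.
elim: w => //= c w IH cw; rewrite IH ?(path_sorted cw) // mulr1.
have /allP {}cw := order_path_min le_ord_trans cw.
by rewrite big_seq_cond big1 // => d /andP[/cw] /= cd; rewrite ltnNge [(c <= d)%N]cd.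
Qed.

(** Once the rest of the word is sorted, only pairs involving the inserted letter can be out of
    order. *)
Lemma osign_insert pre a suf : sorted le_ (pre ++ suf) ->
  osign F m n (pre ++ a :: suf) =
  (\prod_(d <- pre | (a < d)%N) eps d a) * \prod_(d <- suf | (d < a)%N) eps a d.
Proof.
elim: pre => [|c pre IH] /= => [/osign_sorted->|cw]; first by rewrite big_nil mul1r mulr1.
rewrite IH ?(path_sorted cw) // mulrA; congr (_ * _).
have /allP {}cw := order_path_min le_ord_trans cw.
have P1 (s : seq I) : {subset s <= pre ++ suf} -> \prod_(d <- s | (d < c)%N) eps c d = 1.
  move=> sw; rewrite big_seq_cond big1 // => d /andP[/sw/cw].
  by rewrite /le_ ltnNge => ->.
rewrite big_cat big_cons [in RHS]big_cons !P1 /=; last 2 first.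
- by move=> d; rewrite mem_cat => ->; rewrite orbT.
- by move=> d; rewrite mem_cat => ->.
by case: ifP => _; rewrite ?mulr1 mul1r.
Qed.

(* The sign of moving [e_a] from the end of a sorted word to its place. *)
Definition oside a k : F := \prod_(d : I | (a < d)%N) eps a d ^+ k d.

Lemma oside_okey a w : oside a (okey w) = \prod_(d <- w | (a < d)%N) eps a d.
Proof. by rewrite prod_countE; apply: eq_bigr => d _; rewrite ffunE. Qed.

Lemma oside_sq a k : oside a k * oside a k = 1.
Proof. by rewrite -big_split big1 // => d _ /=; rewrite -exprMn eps_sq expr1n. Qed.

Lemma oside_neq0 a k : oside a k != 0.
Proof. by apply/eqP => E; have /eqP := oside_sq a k; rewrite E mul0r eq_sym oner_eq0. Qed.

Lemma oside_add b k a : oside b (oadd k a) = oside b k * (if (b < a)%N then eps b a else 1).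
Proof.
rewrite /oside; under eq_bigr do rewrite ffunE exprD.
rewrite big_split /=; congr (_ * _); case: ifP => ba.
  by rewrite (bigD1 a) //= eqxx expr1 big1 ?mulr1 // => c /andP[_ /negbTE->].
by rewrite big1 // => c bc; case: eqP => // E; rewrite -E bc in ba.
Qed.

Definition wedge a k : F * O := ((okvalid (oadd k a))%:R * oside a k, oadd k a).
(** The right contraction A_b: the power of e_b is differentiated, whence the factor [k b], and the
    sign is that of bringing one e_b to the right end of the word. *)
Definition contr b k : F * O := ((k b)%:R * oside b k, osub k b).

Variables (V : lmodType F) (e : Key m n -> V).

Lemma wedgeC p a c k : tens e p (bind (wedge c k) (wedge a)) =
  eps a c *: tens e p (bind (wedge a k) (wedge c)).
Proof.
have [<-|ac] := eqVneq a c.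
  have [oa|oa] := boolP (odd_ a); first by rewrite (eps_odd oa) scale1r.
  have E : (bind (wedge a k) (wedge a)).1 = 0.
    rewrite /= (_ : okvalid (oadd (oadd _ _) _) = false) ?(mul0r, mulr0) //.
    apply/negP => /okvalidP/(_ a oa); rewrite !ffunE eqxx -addnA.
    by rewrite addn2 ltnS.
  by rewrite (tens0r _ _ E) scaler0.
rewrite -tensZr.
apply: tens_eqr => /= [|_]; last exact: oaddAC.
rewrite !oside_add (oaddAC k c a).
have [v|_] := boolP (okvalid (oadd (oadd k a) c)); last by rewrite !(mul0r, mulr0).
rewrite (okvalid_addW v); rewrite oaddAC in v; rewrite (okvalid_addW v) !mul1r.
case: (ltngtP a c) => [h|h|/val_inj E]; last by rewrite E eqxx in ac.
  by rewrite mulr1; ring.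
rewrite mulr1 (epsC c a); have := eps_sq a c; move: (eps a c) (oside _ _) (oside _ _) => z x y E.
by transitivity ((z * z) * (x * y)); [rewrite E; ring|ring].
Qed.

(** The canonical commutation relation between contraction and multiplication. For odd a = b it
    reads k + 1 = 1 + k in terms of the multiplicity. *)
Lemma contr_wedge p a b k : okvalid k ->
  tens e p (bind (wedge a k) (contr b)) =
  (a == b)%:R *: tens e p (1, k) + eps a b *: tens e p (bind (contr b k) (wedge a)).
Proof.
move=> vk; have [<-|ab] := eqVneq a b.
  rewrite -!tensZr /bind /= oaddK; have [ka|ka] := posnP (k a).
    rewrite [X in _ = _ + X]tens0r /=; last by rewrite ka !(mul0r, mulr0).
    rewrite addr0; apply: tens_eqr => //=.
    rewrite ffunE okvalid_add // ka eqxx orbT mul1r oside_add ltnn mulr1.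
    by rewrite eqxx add0n mulr1n !mul1r oside_sq.
  rewrite osubK // -tensDr; apply: tens_eqr => //=.
  have -> : oside a (osub k a) = oside a k.
    by rewrite -[in RHS](osubK ka) oside_add ltnn mulr1.
  rewrite ffunE oside_add ltnn mulr1 eqxx okvalid_add // vk !mul1r.
  have [oa|oa] /= := boolP (odd_ a).
    by rewrite eps_odd // !mul1r addn1 -natr1 mulrCA -mulrA oside_sq !mulr1 addrC.
  (* An even letter already present has multiplicity exactly 1: the left side vanishes because e_a
     would be repeated, and the right side is 1 - 1. *)
  have /okvalidP/(_ a oa) := vk; case: (k a) ka => // -[] // _ _.
  rewrite !mul0r /Defs.eps (negbTE oa) /= /Defs.sgn expr0.
  by rewrite mulN1r !mul1r oside_sq subrr.
rewrite scale0r add0r -tensZr.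
have [kb|kb] := posnP (k b).
  by rewrite !tens0r //= ?ffunE kb ?(eq_sym b) ?(negbTE ab) !(mul0r, mulr0).
apply: tens_eqr => /= [|_]; last exact: osub_add.
rewrite ffunE eq_sym (negbTE ab) addn0 !okvalid_add ?okvalid_sub //.
rewrite ffunE (negbTE ab) subn0.
have -> : oside a k = oside a (osub k b) * (if (a < b)%N then eps a b else 1).
  by rewrite -[in LHS](osubK kb) oside_add.
rewrite oside_add.
move: (_%:R) (_%:R) => x y.
case: (ltngtP a b) => [h|h|/val_inj E]; last by rewrite E eqxx in ab.
  by rewrite mulr1; ring.
by rewrite mulr1 (epsC b a); ring.
Qed.

Lemma contr_wedge_diag p b k : okvalid k ->
  tens e p (bind (contr b k) (wedge b)) = (k b)%:R *: tens e p (1, k).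
Proof.
move=> vk; rewrite -tensZr; have [kb|kb] := posnP (k b).
  by rewrite !tens0r //= kb !mul0r.
apply: tens_eqr => /= [|_]; last exact: osubK.
have -> : oside b (osub k b) = oside b k.
  by rewrite -[in RHS](osubK kb) oside_add ltnn mulr1.
by rewrite osubK // vk mul1r mulr1 -mulrA oside_sq mulr1.
Qed.

Definition mono (key : Key m n) : M F m n := << key >>.

Lemma tens_mono p q : tens mono p q = << p.1 * q.1 *g (p.2, q.2) >>.
Proof. exact: esym (malgUZ _ _). Qed.

Lemma ovecR_rcons (c : F) (r : R) k a : ovecR F m n c r (rcons (oword k) a) =
  tens mono (c, r) (wedge a k).
Proof.
have Es : osign F m n (rcons (oword k) a) = oside a k.
  rewrite -cats1 osign_insert ?cats0 ?oword_sorted // big_nil mulr1.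
  by rewrite -{2}(owordK k) oside_okey; apply: eq_bigr => d _; rewrite epsC.
rewrite /ovecR (_ : ovalid m n _ = okvalid (okey (rcons (oword k) a))); last first.
  by apply: eq_forallb => d; rewrite ffunE.
have -> : okey (rcons (oword k) a) = oadd k a.
  apply/ffunP => d; rewrite !ffunE -cats1 count_cat count_oword /= addn0 eq_sym.
  by [].
rewrite tens_mono /wedge /=; case: ifP => _; last by rewrite mul0r mulr0 monalgU0.
by rewrite Es mul1r.
Qed.

(** Replacing a letter in place is compared with removing it and then appending the new letter at
    the right end. The prefix sign of the superderivation thereby becomes a sign of the whole
    remaining word. *)
Lemma xi_term a b (c : F) (r : R) pre suf : sorted le_ (pre ++ b :: suf) ->
  okvalid (okey (pre ++ b :: suf)) ->
  let k := okey (pre ++ b :: suf) in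
  ovecR F m n (c * sgn ((odd_ a (+) odd_ b) && odd (count odd_ pre))) r (pre ++ a :: suf) =
  << c * (sgn ((odd_ a (+) odd_ b) && (opar k (+) odd_ b)) * oside b k * (wedge a (osub k b)).1)
     *g (r, oadd (osub k b) a) >>.
Proof.
move=> srt vk k.
have Ek : osub k b = okey (pre ++ suf).
  apply/ffunP => d; rewrite !ffunE !count_cat /= eq_sym.
  by rewrite addnCA addnC addnK.
have Ek' : oadd (osub k b) a = okey (pre ++ a :: suf).
  by rewrite Ek; apply/ffunP => d; rewrite !ffunE !count_cat /= eq_sym addnC addnCA.
rewrite /ovecR (_ : ovalid m n _ = okvalid (okey (pre ++ a :: suf))); last first.
  by apply: eq_forallb => d; rewrite ffunE.
rewrite /= -Ek'; case: ifP => va; last by rewrite mul0r !mulr0 monalgU0.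
apply: (congr1 (fun x => << x *g _ >>)); rewrite mul1r -mulrA; congr (c * _).
have srt' : sorted le_ (pre ++ suf).
  by apply: (subseq_sorted le_ord_trans _ srt); rewrite subseq_cat2l subseq_cons.
rewrite osign_insert // Ek oside_okey big_cat /=.
have -> : opar k (+) odd_ b = odd (count odd_ pre) (+) odd (count odd_ suf).
  by rewrite opar_okey count_cat oddD /= oddD oddb addbA addbAC addbK.
have count2 x : x \in suf -> ~~ (count_mem x pre + (true + count_mem x suf) <= 1)%N.
  by rewrite -has_pred1 has_count addnCA add1n ltnS leqn0 addn_eq0 negb_and -!lt0n => ->; rewrite orbT.
(* The product may run over all of [suf]: a further occurrence of [b] forces [b] to be odd, and then
   its factor is 1. *)
have Eb : oside b k = \prod_(d <- suf) eps b d.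
  rewrite oside_okey big_cat big_cons ltnn /=.
  have /allP bs : all (le_ b) suf.
    by have := order_path_min le_ord_trans (cat_sorted2 srt).2.
  have pb : {in pre, forall d, (d <= b)%N}.
    move=> d dp; move: srt; case/splitPr: dp => p1 p2; rewrite -catA /=.
    move=> /cat_sorted2[_] /= /(order_path_min le_ord_trans)/allP; apply.
    by rewrite mem_cat inE eqxx orbT.
  rewrite big_seq_cond big1 ?mul1r; last first.
    by move=> d /andP[/pb]; rewrite leqNgt => /negbTE->.
  rewrite big_mkcond !big_seq; apply: eq_bigr => d ds; case: ifP => //.
  have := bs d ds; rewrite /le_ leq_eqVlt => /orP[/eqP/val_inj E _|->//].
  rewrite -E eps_odd //; apply/negPn/negP => ob.
  have /okvalidP/(_ b ob) := vk; rewrite ffunE count_cat /= eqxx.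
  by apply/negP/count2; rewrite E.
(* Letters above [a] are counted twice on the right and square to 1; a letter equal to [a] must be
   odd because the new word is valid. *)
have Ea : \prod_(d <- suf | (d < a)%N) eps a d =
    (\prod_(d <- suf | (a < d)%N) eps a d) * \prod_(d <- suf) eps a d.
  rewrite big_mkcond [X in _ = X * _]big_mkcond -big_split /= !big_seq.
  apply: eq_bigr => d ds; case: ltngtP => [||/val_inj E]; rewrite ?mul1r ?eps_sq //.
  rewrite E eps_odd //; apply/negPn/negP => oa.
  move: va; rewrite Ek' => /okvalidP/(_ a oa).
  rewrite ffunE count_cat /= eqxx.
  by apply/negP/count2; rewrite -E.
(* The minus signs in [eps] cancel, leaving the sign of moving E_ab past the suffix; this extends
   the prefix sign to the whole word. *)
have Eab : (\prod_(d <- suf) eps a d) * (\prod_(d <- suf) eps b d) =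
    sgn ((odd_ a (+) odd_ b) && odd (count odd_ suf)).
  rewrite -big_split /= (eq_bigr (fun d => sgn ((odd_ a (+) odd_ b) && odd_ d))); last first.
    move=> d _; rewrite /Defs.eps mulrNN -sgnD; congr sgn.
    by case: (odd_ a); case: (odd_ b); case: (odd_ d).
  rewrite prod_sgn; case: (odd_ a (+) odd_ b) => /=; last by rewrite (eq_count (a2 := pred0)) ?count_pred0.
  by congr (sgn (odd _)); apply: eq_count => d.
have Eb2 : (\prod_(d <- suf) eps b d) * (\prod_(d <- suf) eps b d) = 1.
  by rewrite -big_split big1 // => d _ /=; rewrite eps_sq.
rewrite Eb Ea (eq_bigr (eps a)); last by move=> d _; rewrite epsC.
have -> : sgn ((odd_ a (+) odd_ b) && (odd (count odd_ pre) (+) odd (count odd_ suf))) =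
  sgn ((odd_ a (+) odd_ b) && odd (count odd_ pre)) *
  sgn ((odd_ a (+) odd_ b) && odd (count odd_ suf)).
  by rewrite -sgnD andb_addr.
rewrite -Eab.
move: (\prod_(d <- suf) eps b d) Eb2 => z E.
by rewrite -[LHS]mulr1 -E; ring.
Qed.

(** By [xi_term] the contribution is the same at each of the [k b] positions of the letter, and this
    multiplicity is the factor in the contraction. *)
Lemma xiEE a b (c : F) (r : R) k : okvalid k ->
  xiE F m n a b c r k =
  sgn ((odd_ a (+) odd_ b) && (opar k (+) odd_ b)) *:
    tens mono (c, r) (bind (contr b k) (wedge a)).
Proof.
move=> vk; rewrite /xiE.
set t := << c * (sgn ((odd_ a (+) odd_ b) && (opar k (+) odd_ b)) * oside b k *
   (wedge a (osub k b)).1) *g (r, oadd (osub k b) a) >> : M F m n.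
transitivity (\sum_(p < size (oword k) | nth a (oword k) p == b) t).
  apply: eq_bigr => p /eqP np.
  have Ew : oword k = take p (oword k) ++ b :: drop p.+1 (oword k).
    by rewrite -np -drop_nth ?cat_take_drop.
  rewrite set_nthE ltn_ord; set pre := take _ _; set suf := drop _ _.
  have := @xi_term a b c r pre suf; rewrite -Ew owordK oword_sorted.
  by move=> -> //.
have -> : \sum_(p < size (oword k) | nth a (oword k) p == b) t = t *+ k b.
  rewrite -(big_mkord (fun p => nth a (oword k) p == b) (fun _ => t)).
  rewrite -(big_nth a (fun x => x == b) (fun _ => t)).
  by rewrite big_const_seq iter_addr_0 count_oword.
rewrite -tensZr tens_mono /t -scaler_nat malgUZE /=.
by apply: (congr1 (fun x => << x *g _ >>)); ring.
Qed.

End SuperGrassmann.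

(** * Anticommuting pieces of the differential and Cartan's formula, one index at a time *)

(* [V] and [e] stand for the module [{malg F[Key m n]}] and its basis: unification
   inside the concrete type is prohibitively slow. *)
Section CartanCalculus.
Variables (F : fieldType) (m n : nat).
Local Notation R := (Rkey m n).
Local Notation O := (Okey m n).
Local Notation I := 'I_(m + n).
Local Notation odd_ := (@oddi m n).
Local Notation eps := (eps F m n).
Local Notation sgn := (sgn F).
Local Notation okvalid := (okvalid m n).
Local Notation opar := (opar m n).
Local Notation rpar := (rpar m n).
Local Notation rmul := (rmul F m n).
Local Notation pd := (@pd F m n).
Local Notation wedge := (@wedge F m n).
Local Notation contr := (@contr F m n).
Implicit Types (a b c : I) (k : O) (r f : R) (p : F * R) (q : F * O).

Variables (V : lmodType F) (e : Key m n -> V).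
Local Notation tens_ := (tens e).

Definition dterm a (key : Key m n) : V :=
  sgn (odd_ a && ~~ (opar key.2 (+) rpar key.1)) *: tens_ (pd a key.1) (wedge a key.2).

(** The interior product with f P_b. Its sign follows the same rule as that of [dterm]; this makes
    the mixed terms cancel in Cartan's formula. *)
Definition ikey f b (key : Key m n) : V :=
  sgn (odd_ b && ~~ (opar key.2 (+) rpar key.1)) *: tens_ (rmul f key.1) (contr b key.2).

(** The first factor is the sign in the definition of the action, the second comes from rewriting
    E_ab by [xiEE]. *)
Definition actsign f b a r k : F :=
  sgn (if odd_ b then (if odd_ a then ~~ rpar f else rpar r)
       else odd_ a && ~~ (rpar f (+) rpar r)) *
  sgn ((odd_ a (+) odd_ b) && (opar k (+) odd_ b)).

Definition actterm f b a r k : V :=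
  actsign f b a r k *: tens_ (bind (pd a f) (rmul ^~ r)) (bind (contr b k) (wedge a)).

Definition dsum (key : Key m n) : V := \sum_a dterm a key.

Definition actsum f b (key : Key m n) : V :=
  tens_ (bind (pd b key.1) (rmul f)) (1, key.2) + \sum_a actterm f b a key.1 key.2.

Variable L : (Key m n -> V) -> {linear V -> V}.
Hypothesis Le : forall T key, L T (e key) = T key.

Lemma L_tens T p q : L T (tens_ p q) = (p.1 * q.1) *: T (p.2, q.2).
Proof. by rewrite linearZ /= Le. Qed.

Lemma tens_bind p q (G : R -> F * R) (H : O -> F * O) :
  (p.1 * q.1) *: tens_ (G p.2) (H q.2) = tens_ (bind p G) (bind q H).
Proof. by rewrite /tens scalerA /=; congr (_ *: _); ring. Qed.

(** Parities of the resulting monomials are known only where the scalars are nonzero; elsewhere both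
    sides are zero. *)
Lemma scaled_sign p q x y (h : bool -> bool) :
  (p.1 != 0 -> rpar p.2 = x) -> (q.1 != 0 -> opar q.2 = y) ->
  (p.1 * q.1) * sgn (h (opar q.2 (+) rpar p.2)) = sgn (h (y (+) x)) * (p.1 * q.1).
Proof.
have [->|p0] := eqVneq p.1 0; first by rewrite !(mul0r, mulr0).
have [->|q0] := eqVneq q.1 0; first by rewrite !(mul0r, mulr0).
by move=> -> // -> //; rewrite mulrC.
Qed.

Lemma L_dterm a p q x y :
  (p.1 != 0 -> rpar p.2 = x) -> (q.1 != 0 -> opar q.2 = y) ->
  L (dterm a) (tens_ p q) =
  sgn (odd_ a && ~~ (y (+) x)) *: tens_ (bind p (pd a)) (bind q (wedge a)).
Proof.
move=> px qy; rewrite L_tens /dterm scalerA.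
by rewrite (scaled_sign (fun z => odd_ a && ~~ z) px qy) -scalerA tens_bind.
Qed.

Lemma L_ikey f b p q x y :
  (p.1 != 0 -> rpar p.2 = x) -> (q.1 != 0 -> opar q.2 = y) ->
  L (ikey f b) (tens_ p q) =
  sgn (odd_ b && ~~ (y (+) x)) *: tens_ (bind p (rmul f)) (bind q (contr b)).
Proof.
move=> px qy; rewrite L_tens /ikey scalerA.
by rewrite (scaled_sign (fun z => odd_ b && ~~ z) px qy) -scalerA tens_bind.
Qed.

Lemma wedge_par a k : (wedge a k).1 != 0 -> opar (wedge a k).2 = opar k (+) odd_ a.
Proof. by rewrite opar_add. Qed.

Lemma contr_coef_gt0 b k : (contr b k).1 != 0 -> (0 < k b)%N.
Proof. by rewrite mulf_eq0 negb_or => /andP[/natr_neq0_gt0]. Qed.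

Lemma contr_par b k : (contr b k).1 != 0 -> opar (contr b k).2 = opar k (+) odd_ b.
Proof. by move/contr_coef_gt0/opar_sub. Qed.

(** P_a and e_a together preserve the total parity, so the signs of the differential are symmetric
    in [a] and [c]. Exchanging the derivations and exchanging the wedge factors give -1 in total. *)
Lemma dterm_dterm a c key : L (dterm c) (dterm a key) = - L (dterm a) (dterm c key).
Proof.
case: key => r k.
have H a' c' : L (dterm c') (dterm a' (r, k)) =
    sgn (odd_ a' && ~~ (opar k (+) rpar r)) *: (sgn (odd_ c' && ~~
      (opar k (+) odd_ a' (+) (rpar r (+) odd_ a'))) *:
      tens_ (bind (pd a' r) (pd c')) (bind (wedge a' k) (wedge c'))).
  by rewrite /dterm linearZ (L_dterm _ (@pd_par F m n a' r) (@wedge_par a' k)).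
rewrite !H pdC wedgeC !scalerA -scaleNr; congr (_ *: _).
rewrite /Defs.eps; move: (odd_ a) (odd_ c) (opar k) (rpar r) => [] [] [] [] /=;
  rewrite /Defs.sgn /= ?expr0 ?expr1; ring.
Qed.

Lemma dsum_dsum key : [pchar F] =i pred0 -> \sum_c L (dterm c) (dsum key) = 0.
Proof.
move=> charF; set S := \sum_c _.
have SE : S = \sum_c \sum_a L (dterm c) (dterm a key).
  by apply: eq_bigr => c _; rewrite linear_sum.
have SN : S = - S.
  rewrite {1}SE exchange_big /= SE -sumrN; apply: eq_bigr => a _.
  by rewrite -sumrN; apply: eq_bigr => c _; exact: dterm_dterm.
(* The diagonal terms are covered too: S = -S forces S = 0 because 2 is invertible. *)
have : (2%:R : F) *: S = 0 by rewrite scaler_nat mulr2n {2}SN subrr.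
move/eqP; rewrite scaler_eq0 => /orP[|/eqP//].
by have /pcharf0P-> := charF.
Qed.

(** The cancellation pattern of Cartan's formula: [u] differentiates f, [v] is the mixed term that
    differentiates g and exchanges a letter, and [w] is the transport term, with [d] the Kronecker
    delta. *)
Lemma lincomb_cancel (x y z z' d : F) (u v w : V) :
  x * z + y * z' = 0 -> y * d = d ->
  x *: (u + z *: v) + y *: (d *: w + z' *: v) = d *: w + x *: u.
Proof.
move=> E1 E2; rewrite !scalerDr !scalerA E2 addrACA -scalerDl E1 scale0r addr0.
by rewrite addrC.
Qed.

Lemma cartan_term f b a r k : okvalid k ->
  L (dterm a) (ikey f b (r, k)) + L (ikey f b) (dterm a (r, k)) =
  (a == b)%:R *: tens_ (bind (pd a r) (rmul f)) (1, k) + actterm f b a r k.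
Proof.
move=> vk.
have -> : L (dterm a) (ikey f b (r, k)) =
    sgn (odd_ b && ~~ (opar k (+) rpar r)) *:
    (sgn (odd_ a && ~~ (opar k (+) odd_ b (+) (rpar f (+) rpar r))) *:
     tens_ (bind (rmul f r) (pd a)) (bind (contr b k) (wedge a))).
  by rewrite linearZ (L_dterm _ (@rmul_par F m n f r) (@contr_par b k)).
have -> : L (ikey f b) (dterm a (r, k)) =
    sgn (odd_ a && ~~ (opar k (+) rpar r)) *:
    (sgn (odd_ b && ~~ (opar k (+) odd_ a (+) (rpar r (+) odd_ a))) *:
     tens_ (bind (pd a r) (rmul f)) (bind (wedge a k) (contr b))).
  by rewrite linearZ (L_ikey _ _ (@pd_par F m n a r) (@wedge_par a k)).
rewrite pd_leibniz contr_wedge // !(scalerA _ _ (_ + _)) lincomb_cancel.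
- congr (_ + _); rewrite /actterm; congr (_ *: _); rewrite /actsign.
  move: (odd_ a) (odd_ b) (opar k) (rpar r) (rpar f) => [] [] [] [] [] /=;
  rewrite /Defs.sgn /= ?expr0 ?expr1; ring.
- rewrite /Defs.eps; move: (odd_ a) (odd_ b) (opar k) (rpar r) (rpar f) => [] [] [] [] [] /=;
  rewrite /Defs.sgn /= ?expr0 ?expr1; ring.
- case: eqP => [->|_]; last by rewrite mulr0.
  move: (odd_ b) (opar k) (rpar r) => [] [] [] /=;
  rewrite /Defs.sgn /= ?expr0 ?expr1; ring.
Qed.

Lemma cartan_sum f b key : okvalid key.2 ->
  actsum f b key =
  \sum_a L (dterm a) (ikey f b key) + L (ikey f b) (dsum key).
Proof.
case: key => r k vk; rewrite /actsum /dsum linear_sum -big_split /=.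
rewrite (eq_bigr _ (fun a _ => cartan_term f b a r vk)) big_split /=; congr (_ + _).
rewrite (bigD1 b) //= eqxx scale1r big1 ?addr0 // => a ab.
by rewrite (negbTE ab) scale0r.
Qed.

Lemma dsum_r1 k : dsum (r1 m n, k) = 0.
Proof.
by rewrite /dsum big1 // => a _; rewrite /dterm tens0l ?scaler0 ?pd_r1.
Qed.

Lemma actsum_r1 a r k : actsum (r1 m n) a (r, k) = tens_ (pd a r) (1, k).
Proof.
rewrite /actsum big1 ?addr0 => [|c _].
  by apply: tens_eql; rewrite /bind rmul1l //= mulr1.
by rewrite /actterm tens0l ?scaler0 //= pd_r1 mul0r.
Qed.

(** P_a kills the variable of index [c] unless a = c, so a single gl(m|n) term survives; on
    constants this linear field acts purely through E_cb. *)
Lemma actsum_var c b r k : actsum (var c) b (r, k) =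
  tens_ (bind (pd b r) (rmul (var c))) (1, k) +
  actsign (var c) b c r k *: tens_ (1, r) (bind (contr b k) (wedge c)).
Proof.
rewrite /actsum (bigD1 c) //= big1 ?addr0 => [|a ac].
  congr (_ + _); rewrite /actterm; congr (_ *: _).
  have [E1 /(_ erefl) E2] := pd_var F c c.
  by apply: tens_eql; rewrite /bind E1 E2 eqxx rmul1l //= mulr1.
have [E1 _] := pd_var F a c.
by rewrite /actterm tens0l ?scaler0 //= E1 (negbTE ac) mul0r.
Qed.

Lemma actsum_var_diag b r k : okvalid k ->
  actsum (var b) b (r, k) = (rcount r b + k b)%:R *: e (r, k).
Proof.
move=> vk; have E : actsign (var b) b b r k = 1.
  by rewrite /actsign addbb rpar_var; case: (odd_ b); rewrite /Defs.sgn /= ?expr0 !mul1r.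
rewrite actsum_var rmul_var_pd contr_wedge_diag // E scale1r.
by rewrite natrD scalerDl /tens /= mulr1 scale1r.
Qed.

Lemma actsum_var_r1 c b k : actsum (var c) b (r1 m n, k) =
  actsign (var c) b c (r1 m n) k *: tens_ (1, r1 m n) (bind (contr b k) (wedge c)).
Proof. by rewrite actsum_var tens0l ?add0r //= pd_r1 mul0r. Qed.

Lemma actsign_neq0 f b a r k : actsign f b a r k != 0.
Proof. by rewrite mulf_neq0 // sgn_neq0. Qed.

End CartanCalculus.

(** * The complex itself: equivariance, exactness, generation by constants *)

Section DeRhamComplex.
Variables (F : fieldType) (m n : nat).
Hypothesis charF : [pchar F] =i pred0.
Local Notation R := (Rkey m n).
Local Notation O := (Okey m n).
Local Notation I := 'I_(m + n).
Local Notation odd_ := (@oddi m n).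
Local Notation okvalid := (okvalid m n).
Local Notation odeg := (odeg m n).
Local Notation lin := (lin F m n).
Local Notation M := (M F m n).
Local Notation mono := (@mono F m n).
Local Notation act := (act F m n).
Local Notation dmap := (dmap F m n).
Local Notation Vmod := (Vmod F m n).
Local Notation Imd := (Imd F m n).
Local Notation Kerd := (Kerd F m n).
Local Notation Lmod := (Lmod F m n).
Local Notation is_submod := (is_submod F m n).
Local Notation dsum_ := (@dsum F m n M mono).
Local Notation dterm_ := (@dterm F m n M mono).
Local Notation actsum_ := (@actsum F m n M mono).
Local Notation ikey_ := (@ikey F m n M mono).
Local Notation one := (r1 m n).
Implicit Types (a b c : I) (k : O) (r f : R) (key : Key m n) (T : Key m n -> M).

Lemma lin_comp T T' v : lin T (lin T' v) = lin (fun key => lin T (T' key)) v.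
Proof.
rewrite [lin T' v]/Defs.lin [RHS]/Defs.lin linear_sum.
by apply: eq_bigr => key _; exact: linZ.
Qed.

Lemma lin_addf T T' v : lin T v + lin T' v = lin (fun key => T key + T' key) v.
Proof. by rewrite /Defs.lin -big_split; apply: eq_bigr => key _; rewrite /= scalerDr. Qed.

Lemma lin_sumf (J : Type) (s : seq J) (T : J -> Key m n -> M) v :
  lin (fun key => \sum_(j <- s) T j key) v = \sum_(j <- s) lin (T j) v.
Proof.
rewrite /Defs.lin exchange_big; apply: eq_bigr => key _ /=.
by rewrite scaler_sumr.
Qed.

Lemma eq_lin_supp T T' v :
  (forall key, key \in msupp v -> T key = T' key) -> lin T v = lin T' v.
Proof. by move=> E; apply: eq_big_seq => key kv; rewrite (E key kv). Qed.

Lemma lin_mono v : lin mono v = v.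
Proof. by rewrite [RHS]monalgE; apply: eq_bigr => key _; exact: esym (malgUZ _ _). Qed.

Definition linL T : {linear M -> M} := lin T.

Lemma linLU T key : linL T (mono key) = T key.
Proof. exact: etrans (linU T 1 key) (scale1r _). Qed.

Lemma lin0 T : lin T 0 = 0.
Proof. exact: (linear0 (linL T)). Qed.

Lemma linB T u v : lin T (u - v) = lin T u - lin T v.
Proof. exact: (linearB (linL T)). Qed.

Lemma dkeyE key : dkey F m n key = dsum_ key.
Proof.
rewrite /dsum big_split_ord /dkey; apply: f_equal2.
  apply: eq_bigr => i _; rewrite ovecR_rcons /dterm oddi_evI pd_evI -surjective_pairing.
  exact: esym (scale1r _).
rewrite scaler_sumr; apply: eq_bigr => j _.
by rewrite ovecR_rcons /dterm oddi_odI pd_odI -surjective_pairing.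
Qed.

Definition Wvec f b : Wbasis m n :=
  match split b with inl i => Wd m n f i | inr j => WD m n f j end.

Lemma WvecP (X : Wbasis m n) : exists f b, X = Wvec f b.
Proof.
case: X => f i; exists f; [exists (evI m n i) | exists (odI m n i)].
  by rewrite /Wvec split_evI.
by rewrite /Wvec split_odI.
Qed.

Lemma act_d_sum f i r k : okvalid k -> act_d F m n f i (r, k) = actsum_ f (evI m n i) (r, k).
Proof.
move=> vk; rewrite /actsum big_split_ord addrA /act_d; cbv zeta.
apply: f_equal2; first apply: f_equal2.
- by rewrite pd_evI tens_mono /= mulr1.
- apply: eq_bigr => j _; rewrite (xiEE _ _ _ _ vk) /actterm /actsign !oddi_evI pd_evI.
  by apply: f_equal2; [exact: esym (mul1r _) | by []].
- rewrite scaler_sumr; apply: eq_bigr => j _.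
  by rewrite (xiEE _ _ _ _ vk) /actterm /actsign !oddi_odI pd_odI oddi_evI scalerA.
Qed.

Lemma act_D_sum f i r k : okvalid k -> act_D F m n f i (r, k) = actsum_ f (odI m n i) (r, k).
Proof.
move=> vk; rewrite /actsum big_split_ord addrA /act_D; cbv zeta.
apply: f_equal2; first apply: f_equal2.
- by rewrite pd_odI tens_mono /= mulr1.
- rewrite scaler_sumr; apply: eq_bigr => j _.
  by rewrite (xiEE _ _ _ _ vk) /actterm /actsign !oddi_evI pd_evI oddi_odI scalerA.
- rewrite scaler_sumr; apply: eq_bigr => j _.
  by rewrite (xiEE _ _ _ _ vk) /actterm /actsign !oddi_odI pd_odI scalerA.
Qed.

(** The ambient space also has basis vectors whose multiplicity function repeats an even letter. The
    formulas for the action are established on the span of the others. *)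
Definition valid (v : M) := forall key, key \in msupp v -> okvalid key.2.

Lemma act_lin f b v : valid v -> act (Wvec f b) v = lin (actsum_ f b) v.
Proof.
move=> vv; rewrite /Defs.act /Wvec; case: (split_ordP b) => [i ->|j ->];
  apply: eq_lin_supp => -[r k] /vv; [exact: act_d_sum | exact: act_D_sum].
Qed.

Lemma valid_mono r k : okvalid k -> valid (mono (r, k)).
Proof. by move=> vk key /msuppU_mem[_ ->]. Qed.

Lemma act_mono f b r k : okvalid k -> act (Wvec f b) (mono (r, k)) = actsum_ f b (r, k).
Proof.
by move=> vk; apply: (etrans (act_lin f b (@valid_mono r k vk))); exact: linLU.
Qed.

Lemma dmap_mono key : dmap (mono key) = dsum_ key.
Proof. by apply: etrans (linLU _ key) _; exact: dkeyE. Qed.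

Lemma dmapE v : dmap v = \sum_a lin (dterm_ a) v.
Proof.
rewrite -lin_sumf /Defs.dmap; apply: eq_lin_supp => key _; exact: dkeyE.
Qed.

Lemma lin_zero (v : M) : lin (fun=> 0) v = 0.
Proof. by rewrite /Defs.lin big1 // => key _; exact: scaler0. Qed.

Lemma dmap_dmap v : dmap (dmap v) = 0.
Proof.
rewrite /Defs.dmap lin_comp; apply: etrans _ (lin_zero v).
apply: eq_lin_supp => key _; rewrite dkeyE; apply: etrans (dmapE _) _.
exact: (dsum_dsum (L := linL) linLU key charF).
Qed.

Definition iprod f b : M -> M := lin (ikey_ f b).

Lemma cartan f b v : valid v ->
  act (Wvec f b) v = dmap (iprod f b v) + iprod f b (dmap v).
Proof.
move=> vv; rewrite (act_lin f b vv) /iprod /Defs.dmap !lin_comp lin_addf.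
apply: eq_lin_supp => key /vv vk; rewrite dkeyE.
apply: etrans (cartan_sum (L := linL) linLU f b vk) _.
by apply: f_equal2; [exact: esym (dmapE _) | by []].
Qed.

Lemma Vmod_valid K v : Vmod K v -> valid v.
Proof. by move=> vv key /vv[]. Qed.

Lemma Vmod_subspace K : is_subspace F m n (Vmod K).
Proof.
split; first by move=> key; rewrite msupp0 in_fset0.
split=> [u v uK vK key|c v vK key].
  by move/(fsubsetP (msuppD_le u v)); rewrite in_fsetU => /orP[/uK|/vK].
by move/(fsubsetP (msuppZ_le c v))/vK.
Qed.

Lemma msupp_tens (x : F) p q key : key \in msupp (x *: tens mono p q) ->
  [/\ p.1 != 0, q.1 != 0 & key = (p.2, q.2)].
Proof.
move/(fsubsetP (msuppZ_le x _)); rewrite tens_mono => /msuppU_mem[].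
by rewrite mulf_eq0 negb_or => /andP[].
Qed.

Lemma Vmod_dmap K v : Vmod K v -> Vmod K.+1 (dmap v).
Proof.
move=> vK key; rewrite dmapE => /msupp_sum_mem[a _] /msupp_lin_mem[l /vK[vl dl]].
rewrite /dterm => /msupp_tens[_ + ->]; rewrite /= odeg_add dl.
by case: (okvalid _) => //; rewrite mul0r eqxx.
Qed.

Lemma Vmod_iprod K f b v : Vmod K.+1 v -> Vmod K (iprod f b v).
Proof.
move=> vK key /msupp_lin_mem[l /vK[vl dl]].
rewrite /ikey => /msupp_tens[_ /contr_coef_gt0 lb ->] /=.
split; first exact: okvalid_sub.
by apply: succn_inj; rewrite -dl (odeg_sub lb).
Qed.

(** Contraction lowers the form degree and the differential raises it, so Cartan's formula gives
    stability without inspecting the action. *)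
Lemma Vmod_submod K : is_submod (Vmod K.+1).
Proof.
have [V0 [VD VZ]] := Vmod_subspace K.+1.
split=> // X v vK; have [f [b ->]] := WvecP X.
rewrite (cartan f b (Vmod_valid vK)); apply: VD.
  exact/Vmod_dmap/Vmod_iprod.
exact/Vmod_iprod/Vmod_dmap.
Qed.

Lemma cartan_closed f b v : valid v -> dmap v = 0 -> act (Wvec f b) v = dmap (iprod f b v).
Proof.
move=> vv dv; apply: (etrans (cartan f b vv)).
have E : iprod f b (dmap v) = 0 := etrans (congr1 (iprod f b) dv) (lin0 _).
exact: etrans (congr1 (+%R (dmap (iprod f b v))) E) (addr0 _).
Qed.

Lemma dmap_act K X v : Vmod K v -> dmap (act X v) = act X (dmap v).
Proof.
move=> vK; have [f [b ->]] := WvecP X.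
apply: (etrans (congr1 dmap (cartan f b (Vmod_valid vK)))).
apply: (etrans (linD _ _ _)); apply: (etrans (congr1 (+%R^~ _) (dmap_dmap _))).
apply: (etrans (add0r _)); apply: esym.
exact: cartan_closed (Vmod_valid (Vmod_dmap vK)) (dmap_dmap v).
Qed.

Lemma Imd_submod K : is_submod (Imd K).
Proof.
have [V0 [VD VZ]] := Vmod_subspace K.
split; first split.
- by exists 0; split=> //; exact: esym (lin0 _).
- split=> [_ _ [u [uK ->]] [v [vK ->]]|x _ [v [vK ->]]].
    by exists (u + v); split; [exact: VD | exact: esym (linD _ _ _)].
  by exists (x *: v); split; [exact: VZ | exact: esym (linZ _ _ _)].
- move=> X _ [u [uK ->]]; have [f [b ->]] := WvecP X.
  (* The form d u is closed, so X acts on it as d i_X. *)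
  exists (iprod f b (dmap u)); split; first exact/Vmod_iprod/Vmod_dmap.
  exact: cartan_closed (Vmod_valid (Vmod_dmap uK)) (dmap_dmap u).
Qed.

Definition weight key : F := (rdeg key.1 + odeg key.2)%:R.
(** The inverse of the Euler operator. Weight 0 occurs only at constants of form degree 0, where the
    inverse is the default value 0. *)
Definition unweight : M -> M := lin (fun key => (weight key)^-1 *: mono key).

(** The differential trades one polynomial degree for one form degree, so the weight is
    preserved. *)
Lemma unweight_dterm a key :
  unweight (dterm_ a key) = (weight key)^-1 *: dterm_ a key.
Proof.
apply: (etrans (linZ _ _ _)); apply: (etrans (congr1 _ (L_tens (L := linL) linLU _ _ _))).
rewrite /dterm [in RHS]scalerA [in RHS]mulrC -[in RHS]scalerA; apply: f_equal2; first by [].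
rewrite /tens scalerA scalerA mulrC; apply: f_equal2; last by [].
have [p0|p0] := eqVneq (pd F a key.1).1 0; first by rewrite p0 mul0r !mulr0.
have [q0|q0] := eqVneq (wedge F a key.2).1 0; first by rewrite q0 !mulr0.
by rewrite /weight /= odeg_add (pd_deg p0) addSnnS.
Qed.

Lemma dmap_unweight v : dmap (unweight v) = unweight (dmap v).
Proof.
rewrite /Defs.dmap /unweight !lin_comp; apply: eq_lin_supp => key _.
apply: (etrans (linZ _ _ _)); rewrite dkeyE -/(unweight _).
apply: (etrans (congr1 _ (dmap_mono key))).
apply: esym; apply: (etrans (linear_sum (linL _) _ _ _)).
rewrite /dsum scaler_sumr; apply: eq_bigr => a _; exact: unweight_dterm.
Qed.

Lemma euler v : valid v ->
  \sum_b act (Wvec (var b) b) v = lin (fun key => weight key *: mono key) v.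
Proof.
move=> vv; rewrite (eq_bigr _ (fun b _ => act_lin (var b) b vv)) -lin_sumf.
apply: eq_lin_supp => -[r k] /vv /= vk.
rewrite (eq_bigr _ (fun b _ => actsum_var_diag mono b r vk)) -scaler_suml.
by rewrite -natr_sum big_split /= sum_rcount.
Qed.

Lemma Vmod_unweight K v : Vmod K v -> Vmod K (unweight v).
Proof.
move=> vK key /msupp_lin_mem[l /vK lK].
by move/(fsubsetP (msuppZ_le _ _))/msuppU_mem => [_ ->].
Qed.

Lemma exact_dmap K v : Imd K v <-> Kerd K.+1 v.
Proof.
split=> [[u [uK ->]]|[vK dv]]; first by split; [exact: Vmod_dmap | exact: dmap_dmap].
have [V0 [VD VZ]] := Vmod_subspace K.
have uvK := Vmod_unweight vK.
(* The primitive is the contraction of the Euler field with v divided by its weights; division keeps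
   v closed, so only the term d i_X of Cartan's formula remains. *)
exists (\sum_b iprod (var b) b (unweight v)); split.
  by apply: (big_ind (Vmod K)) => [|u w|b _]; [exact: V0 | exact: VD | exact: Vmod_iprod].
apply: esym; apply: (etrans (linear_sum (linL (dkey F m n)) _ _ _)).
transitivity (\sum_b act (Wvec (var b) b) (unweight v)).
  have duv : dmap (unweight v) = 0.
    exact: etrans (dmap_unweight v) (etrans (congr1 unweight dv) (lin0 _)).
  apply: eq_bigr => b _; exact: esym (cartan_closed _ _ (Vmod_valid uvK) duv).
rewrite (euler (Vmod_valid uvK)) /unweight lin_comp; apply: etrans _ (lin_mono v).
apply: eq_lin_supp => key /vK[_ dK]; apply: (etrans (linZ _ _ _)).
apply: (etrans (congr1 _ (linLU _ key))); rewrite scalerA mulVf ?scale1r //.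
by rewrite /weight dK; have /pcharf0P-> := charF; rewrite addnS.
Qed.

Lemma Vmod_mono K r k : okvalid k -> odeg k = K -> Vmod K (mono (r, k)).
Proof. by move=> vk dk key /msuppU_mem[_ ->]. Qed.

Lemma Imd_const K k : okvalid k -> odeg k = K.+1 -> Imd K (mono (one, k)).
Proof.
move=> vk dk; apply/exact_dmap; split; first exact: Vmod_mono.
by rewrite dmap_mono dsum_r1.
Qed.

Lemma msupp_neq0 (v : M) : v != 0 -> exists key, key \in msupp v.
Proof.
move=> v0; apply/fset0Pn; apply: contraNneq v0 => E; apply/eqP/malgP => key.
by rewrite mcoeff0 mcoeff_outdom // E in_fset0.
Qed.

Lemma mono_neq0 key : mono key <> 0.
Proof. by move/malgP/(_ key); rewrite mcoeffUU mcoeff0 => /eqP; rewrite oner_eq0. Qed.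

(** * Generation by constants and simplicity, with a fixed odd index *)

Section OddIndex.
Variable s : I.
Hypothesis s_odd : odd_ s.

Lemma okvalid_add_s k : okvalid k -> okvalid (oadd k s).
Proof. by move=> vk; rewrite okvalid_add // s_odd. Qed.

Lemma rmul1r f : rmul F m n f one = (1, f).
Proof.
rewrite rmulE /= /mul_sign big1 => [|x _]; last by rewrite big_set0.
rewrite -setI_eq0 setI0 eqxx mulr1 setU0; case: f => al A /=.
by congr (_, (_, _)); apply/ffunP => i; rewrite !ffunE addn0.
Qed.

(** A constant is closed, so the field acts on it as d i_X, and i_X strips the extra e_s and
    multiplies by the polynomial [r]. *)
Lemma dmap_mono_act r k : okvalid k -> exists x : F,
  dmap (mono (r, k)) = x *: act (Wvec r s) (mono (one, oadd k s)).
Proof.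
move=> vk; have vks := okvalid_add_s vk.
set y : F := sgn F (odd_ s && ~~ (opar m n (oadd k s) (+) rpar m n one)) *
  (contr F s (oadd k s)).1.
have y0 : y != 0.
  rewrite mulf_neq0 ?sgn_neq0 //= mulf_neq0 ?oside_neq0 //.
  by have /pcharf0P-> := charF; rewrite ffunE eqxx addn1.
exists y^-1; apply: esym.
have Ea : act (Wvec r s) (mono (one, oadd k s)) = dmap (iprod r s (mono (one, oadd k s))).
  by apply: cartan_closed; [exact: valid_mono | exact: etrans (dmap_mono _) (dsum_r1 _ _)].
have Ei : iprod r s (mono (one, oadd k s)) = y *: mono (r, k).
  apply: (etrans (linLU _ _)); rewrite /ikey /= rmul1r /tens scalerA /= oaddK.
  by rewrite mul1r.
apply: (etrans (congr1 _ (etrans Ea (etrans (congr1 dmap Ei) (linZ _ _ _))))).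
apply: (etrans (scalerA _ _ _)); apply: (etrans (congr1 (fun x => x *: _) (mulVf y0))).
exact: scale1r.
Qed.

Lemma Imd_sub K (S : M -> Prop) : is_submod S ->
  (forall k, okvalid k -> odeg k = K.+1 -> S (mono (one, k))) ->
  forall v, Imd K v -> S v.
Proof.
move=> [[S0 [SD SZ]] SX] Sc _ [u [uK ->]].
have -> : dmap u = \sum_(key <- msupp u) u@_key *: dmap (mono key).
  by apply: eq_bigr => key _; apply: f_equal2 => //; exact: esym (linLU _ key).
rewrite big_seq; apply: (big_ind S) => // -[r k] /uK /= [vk dk]; apply: (SZ).
have [x ->] := dmap_mono_act r vk; apply/SZ/SX/Sc; first exact: okvalid_add_s.
by rewrite odeg_add dk.
Qed.

Lemma Lmod_Imd K v : Lmod K.+1 v <-> Imd K v.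
Proof.
split=> [Lv|Iv S Ssub Sc]; last exact: Imd_sub Sc _ Iv.
by apply: Lv => [|k vk dk]; [exact: Imd_submod | exact: Imd_const].
Qed.

Lemma act_one_lin a v : valid v ->
  act (Wvec one a) v =
  lin (fun key => << (pd F a key.1).1 *g ((pd F a key.1).2, key.2) >>) v.
Proof.
move=> vv; rewrite (act_lin _ _ vv); apply: eq_lin_supp => -[r k] _.
by rewrite actsum_r1 tens_mono /= mulr1.
Qed.

Lemma act_one_coef a v key : valid v -> (pd F a key.1).1 != 0 ->
  (act (Wvec one a) v)@_((pd F a key.1).2, key.2) = v@_key * (pd F a key.1).1.
Proof.
move=> vv p0; rewrite (act_one_lin a vv).
apply: (mcoeff_lin_monomial (c := fun key => (pd F a key.1).1)
          (phi := fun key => ((pd F a key.1).2, key.2))) => //.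
by move=> [r k] [r' k'] /= c0 c0' [E ->]; rewrite (pd_inj c0 c0' E).
Qed.

Lemma pd_exists r : r != one -> exists a, (pd F a r).1 != 0.
Proof.
move=> r1; case: (pickP (fun a => (pd F a r).1 != 0)) => [a|H]; first by exists a.
case/eqP: r1; apply: rcount_eq0 => a.
by apply/eqP; rewrite -(pd_coef_eq0 a r charF); apply/negPn; rewrite H.
Qed.

Lemma act_one_neq0 v key : valid v -> key \in msupp v -> key.1 != one ->
  exists a, act (Wvec one a) v != 0.
Proof.
move=> vv kv /pd_exists[a pa]; exists a; apply/eqP => E.
have := act_one_coef vv pa; rewrite E mcoeff0 => /esym/eqP.
by rewrite mulf_eq0 (negbTE pa) orbF; rewrite -mcoeff_neq0 in kv; rewrite (negbTE kv).
Qed.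

Lemma act_one_msupp a v l : valid v -> l \in msupp (act (Wvec one a) v) ->
  exists2 key, key \in msupp v & rdeg key.1 = (rdeg l.1).+1.
Proof.
move=> vv; rewrite (act_one_lin a vv) => /msupp_lin_mem[key kv].
by move=> /msuppU_mem[/pd_deg E ->]; exists key.
Qed.

Section Submodule.
Variables (K : nat) (T : M -> Prop).
Hypotheses (Tsub : is_submod T) (TV : forall v, T v -> Vmod K v).

(** Induction on a bound for the polynomial degree: a derivation that does not kill some monomial of
    [v] gives a nonzero vector of smaller degree bound. *)
Lemma submod_const N v : T v -> v != 0 ->
  (forall key, key \in msupp v -> (rdeg key.1 <= N)%N) ->
  exists w, [/\ T w, w != 0 & forall key, key \in msupp w -> key.1 = one].
Proof.
elim: N v => [|N IH] v Tv v0 bv; have vv := Vmod_valid (TV Tv).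
(* If all monomials are constant, [v] itself serves; a nonconstant one contradicts the bound 0,
   since some derivation would lower its degree. *)
all: have [/allP H|/allPn[key kv kr]] := boolP (all (fun key => key.1 == one) (msupp v));
  first by exists v; split=> // key /H/eqP.
  have [a pa] := pd_exists kr.
  by have := bv _ kv; rewrite (pd_deg pa).
have [a av] := act_one_neq0 vv kv kr.
apply: (IH _ (Tsub.2 _ _ Tv) av) => l /(act_one_msupp vv)[l' /bv].
by move=> bl E; rewrite E ltnS in bl.
Qed.

Definition off_s k : nat := \sum_(a | a != s) k a.

Lemma odeg_off_s k : odeg k = (k s + off_s k)%N.
Proof. by rewrite /Defs.odeg (bigD1 s). Qed.

Definition spow : O := [ffun a => if a == s then K else 0%N].

Lemma off_s_eq0 k : odeg k = K -> off_s k = 0%N -> k = spow.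
Proof.
move=> dk k0; have ks : k s = K by rewrite -dk odeg_off_s k0 addn0.
apply/ffunP => a; rewrite ffunE; case: eqP => [->//|/eqP as_].
by move/eqP: k0; rewrite sum_nat_eq0 => /forallP/(_ a); rewrite as_ => /eqP.
Qed.

Lemma off_s_gt0 k : (0 < off_s k)%N -> exists2 b, b != s & (0 < k b)%N.
Proof.
rewrite lt0n sum_nat_eq0 negb_forall => /existsP[b].
by rewrite negb_imply -lt0n => /andP[bs kb]; exists b.
Qed.

Lemma off_s_shift b k : b != s -> (0 < k b)%N ->
  off_s k = (off_s (oadd (osub k b) s)).+1 /\ odeg (oadd (osub k b) s) = odeg k.
Proof.
move=> bs kb; have E : odeg (oadd (osub k b) s) = odeg k by rewrite odeg_add -odeg_sub.
split=> //; have := E; rewrite !odeg_off_s !ffunE eqxx (eq_sym s) (negbTE bs) subn0 addn1 addSnnS.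
by move/addnI.
Qed.

Definition gl_coef c b k : F :=
  actsign F (var c) b c one k * ((contr F b k).1 * (wedge F c (osub k b)).1).

Lemma actsum_gl c b k :
  actsum_ (var c) b (one, k) = << gl_coef c b k *g (one, oadd (osub k b) c) >>.
Proof. by rewrite actsum_var_r1 tens_mono malgUZE /= mul1r. Qed.

Lemma gl_coef_neq0 c b k : (0 < k b)%N -> okvalid (oadd (osub k b) c) -> gl_coef c b k != 0.
Proof.
move=> kb vk; rewrite mulf_neq0 ?actsign_neq0 // /= vk mul1r !mulf_neq0 ?oside_neq0 //.
by have /pcharf0P-> := charF; rewrite -lt0n.
Qed.

Lemma gl_coef_gt0 c b k : gl_coef c b k != 0 -> (0 < k b)%N.
Proof. by rewrite !mulf_eq0 !negb_or => /and3P[_ /andP[/natr_neq0_gt0]]. Qed.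

(** For b other than s, E_sb kills the monomials without e_b and lowers [off_s] by one on the rest.
    Distinct survivors stay distinct, so the image is nonzero. *)
Lemma submod_spow N v : T v -> v != 0 ->
  (forall key, key \in msupp v -> key.1 = one /\ (off_s key.2 <= N)%N) ->
  T (mono (one, spow)).
Proof.
have [[T0 [TD TZ]] TX] := Tsub.
elim: N v => [|N IH] v Tv v0 bv; have vK := TV Tv; have vv := Vmod_valid vK.
all: have [/allP H|/allPn[key kv kr]] := boolP (all (fun key => off_s key.2 == 0)%N (msupp v)).
- have E key : key \in msupp v -> key = (one, spow).
    move=> kv; have [_ dk] := vK _ kv; have [r1 _] := bv _ kv.
    by rewrite [key]surjective_pairing r1 (off_s_eq0 dk (eqP (H _ kv))).
  have [key kv] : exists key, key \in msupp v by apply: msupp_neq0.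
  (* With no letters other than s and degree K, the only possible monomial is 1 (x) e_s^K. *)
  have vE : v = v@_(one, spow) *: mono (one, spow).
    apply/malgP => l; rewrite mcoeffZ mcoeffU.
    case: eqP => [->|/eqP ne]; first by rewrite mulr1.
    rewrite mulr0; apply: mcoeff_outdom; apply/negP => /E le.
    by rewrite le eqxx in ne.
  have c0 : v@_(one, spow) != 0 by rewrite mcoeff_neq0 -(E _ kv).
  rewrite -[mono _]scale1r -(mulVf c0) -scalerA -vE; exact: TZ.
- by have [_] := bv _ kv; rewrite leqn0 (negbTE kr).
- apply: (IH v Tv v0) => l lv; split; first by have [] := bv _ lv.
  by rewrite (eqP (H _ lv)).
rewrite -lt0n in kr; have [b bs kb] := off_s_gt0 kr.
pose phi (l : Key m n) := (l.1, oadd (osub l.2 b) s).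
have vE : act (Wvec (var s) b) v = lin (fun l => << gl_coef s b l.2 *g phi l >>) v.
  rewrite (act_lin _ _ vv); apply: eq_lin_supp => -[r k] /bv[/= -> _].
  exact: actsum_gl.
have kc : gl_coef s b key.2 != 0.
  exact: gl_coef_neq0 kb (okvalid_add_s (okvalid_sub b (vv _ kv))).
have phi_inj (l l' : Key m n) : gl_coef s b l.2 != 0 -> gl_coef s b l'.2 != 0 ->
    phi l = phi l' -> l = l'.
  case: l l' => [r k] [r' k'] /= /gl_coef_gt0 c0 /gl_coef_gt0 c0' [-> E].
  by congr (_, _); rewrite -(osubK c0) -(osubK c0') -[osub k b](oaddK _ s) E oaddK.
have C := mcoeff_lin_monomial phi_inj v kc.
have := TX (Wvec (var s) b) v Tv; rewrite vE => Tw.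
apply: (IH _ Tw).
  apply/eqP => Z; move: C; rewrite Z mcoeff0 => /esym/eqP.
  rewrite mulf_eq0 (negbTE kc) orbF.
  by rewrite -mcoeff_neq0 in kv; rewrite (negbTE kv).
move=> l /msupp_lin_mem[[r k] /bv[/= -> off] /msuppU_mem[/gl_coef_gt0 c0 ->]].
split; first by [].
by have [E _] := off_s_shift bs c0; move: off; rewrite E ltnS.
Qed.

(** The reverse path: one letter b of [k] is turned into s, induction applies, and E_bs turns it
    back with a nonzero coefficient because s then occurs. *)
Lemma spow_submod N k : okvalid k -> odeg k = K -> off_s k = N ->
  T (mono (one, spow)) -> T (mono (one, k)).
Proof.
have [[T0 [TD TZ]] TX] := Tsub.
move=> + + + Ts; elim: N k => [|N IH] k vk dk kN; first by rewrite (off_s_eq0 dk kN).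
have k0 : (0 < off_s k)%N by rewrite kN.
have [b bs kb] := off_s_gt0 k0.
have [E dE] := off_s_shift bs kb; set l := oadd (osub k b) s in E dE.
have vl : okvalid l by apply/okvalid_add_s/okvalid_sub.
have Tl : T (mono (one, l)) by apply: IH => //; [rewrite dE | apply: succn_inj; rewrite -E].
have lk : oadd (osub l s) b = k by rewrite oaddK osubK.
have c0 : gl_coef b s l != 0 by apply: gl_coef_neq0; rewrite ?lk // ffunE eqxx addn1.
have E2 : (gl_coef b s l)^-1 *: act (Wvec (var b) s) (mono (one, l)) = mono (one, k).
  apply: (etrans (congr1 _ (etrans (act_mono _ _ _ vl) (actsum_gl _ _ _)))).
  by apply: (etrans (malgUZE _ _ _)); rewrite (mulVf c0) lk.
by rewrite -E2; apply/TZ/TX.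
Qed.

Lemma submod_contains_const v : T v -> v != 0 ->
  forall k, okvalid k -> odeg k = K -> T (mono (one, k)).
Proof.
move=> Tv v0 k vk dk.
have bv key : key \in msupp v -> (rdeg key.1 <= \max_(l <- msupp v) rdeg l.1)%N.
  by move=> kv; exact: leq_bigmax_seq.
have [w [Tw w0 cw]] := submod_const Tv v0 bv.
apply: (spow_submod vk dk erefl).
apply: (@submod_spow (\max_(key <- msupp w) off_s key.2) w Tw w0) => key kw.
split; first exact: cw.
exact: leq_bigmax_seq.
Qed.

End Submodule.
End OddIndex.
End DeRhamComplex.

(** * Simplicity of the images and of the quotients, and their non-isomorphism *)

Section CompositionFactors.
Variables (F : fieldType) (m n : nat).
Hypothesis charF : [pchar F] =i pred0.
Variable s : 'I_(m + n).
Hypothesis s_odd : oddi m n s.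
Local Notation M := (M F m n).
Local Notation mono := (@mono F m n).
Local Notation act := (act F m n).
Local Notation dmap := (dmap F m n).
Local Notation Vmod := (Vmod F m n).
Local Notation Imd := (Imd F m n).
Local Notation Lmod := (Lmod F m n).
Local Notation is_submod := (is_submod F m n).
Local Notation one := (r1 m n).

Lemma okvalid_spow K : okvalid m n (spow s K).
Proof.
apply/okvalidP => a ea; rewrite ffunE; case: eqP => // E.
by rewrite E s_odd in ea.
Qed.

Lemma odeg_spow K : odeg m n (spow s K) = K.
Proof.
rewrite /odeg (bigD1 s) //= ffunE eqxx big1 ?addn0 // => a /negbTE as_.
by rewrite ffunE as_.
Qed.

Lemma Imd_simple K : simple_submod F m n (Imd K).
Proof.
split; first exact: Imd_submod.
split.
  exists (mono (one, spow s K.+1)); split; last exact: mono_neq0.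
  by apply: Imd_const; [exact: charF | exact: okvalid_spow | exact: odeg_spow].
move=> T Tsub TI.
have TV v : T v -> Vmod K.+1 v by move=> /TI[u [uK ->]]; exact: Vmod_dmap.
(* [T] is an arbitrary predicate, so whether it has a nonzero vector is decided classically. *)
case: (classic (exists2 v, T v & v != 0)) => [[v Tv v0]|H]; [right | left].
  apply: (Imd_sub charF s_odd Tsub) => k vk dk.
  exact: (submod_contains_const charF s_odd Tsub TV Tv v0 vk dk).
move=> v Tv; apply/eqP; apply: contraT => v0; case: H.
by exists v.
Qed.

Lemma mod_iso_eq (S T : M -> Prop) : (forall v, S v <-> T v) -> mod_iso F m n S T.
Proof.
move=> ST; exists id; split; last first.
  by split=> [u v _ _ //|w /ST Sw]; exists w.
by split=> //; split=> //; split=> // v /ST.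
Qed.

Lemma Imd_iso_Lmod K : mod_iso F m n (Imd K) (Lmod K.+1).
Proof. by apply: mod_iso_eq => v; apply: iff_sym; exact: (Lmod_Imd charF s_odd). Qed.

Lemma dmap_modhom K : is_modhom F m n (Vmod K) (Imd K) dmap.
Proof.
split; first by move=> u v _ _; exact: linD.
split; first by move=> c v _; exact: linZ.
split; first by move=> v vK; exists v.
by move=> X v vK; exact: (dmap_act charF X vK).
Qed.

(** Up to sign, the differential of y_s (x) e_s^K is 1 (x) e_s^(K+1), which is nonzero since s is
    odd. *)
Lemma dmap_var_neq0 K : dmap (mono (var s, spow s K)) != 0.
Proof.
have vk := okvalid_spow K.
apply/eqP => E; have /malgP/(_ (one, oadd (spow s K) s)) := E.
rewrite dmap_mono /dsum (bigD1 s) //= big1 ?addr0 => [|a as_]; last first.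
  by rewrite /dterm tens0l ?scaler0 //= (pd_var F a s).1 (negbTE as_).
have [E1 /(_ erefl) E2] := pd_var F s s.
rewrite /dterm mcoeffZ tens_mono /= E1 E2 mcoeffUU mcoeff0 eqxx mul1r.
rewrite okvalid_add // s_odd mul1r => /eqP.
by rewrite mulf_eq0 (negbTE (sgn_neq0 _ _)) (negbTE (oside_neq0 _ _ _)).
Qed.

(** The submodule is pushed forward along the differential into the simple module Im d_(K+1). A zero
    image puts [T] in the kernel, which is Im d_K; a full image gives [T] everything. *)
Lemma quotient_simple K (T : M -> Prop) : is_submod T ->
  (forall v, Imd K v -> T v) -> (forall v, T v -> Vmod K.+1 v) ->
  (forall v, T v -> Imd K v) \/ (forall v, Vmod K.+1 v -> T v).
Proof.
move=> Tsub IT TV; have [[T0 [TD TZ]] TX] := Tsub.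
case: (classic (forall v, T v -> Imd K v)) => H; [by left | right].
pose dT w := exists u, T u /\ w = dmap u.
have dTsub : is_submod dT.
  split; first split.
  - by exists 0; split; [exact: T0 | exact: esym (lin0 _)].
  - split=> [_ _ [u [Tu ->]] [v [Tv ->]]|x _ [v [Tv ->]]].
      by exists (u + v); split; [exact: TD | exact: esym (linD _ _ _)].
    by exists (x *: v); split; [exact: TZ | exact: esym (linZ _ _ _)].
  - move=> X _ [u [Tu ->]]; exists (act X u); split; first exact: TX.
    exact: esym (dmap_act charF X (TV u Tu)).
have dTI w : dT w -> Imd K.+1 w by move=> [u [/TV uK ->]]; exists u.
have [_ [_ /(_ dT dTsub dTI)]] := Imd_simple K.+1.
case=> [Z|dTall v vK].
  case: H => v Tv; apply/(exact_dmap charF); split; first exact: TV.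
  by apply: Z; exists v.
have [t [Tt E]] : dT (dmap v) by apply: dTall; exists v.
(* v and t have the same differential, so they differ by a closed form, which is exact and hence
   lies in [T]. *)
have Iw : Imd K (v - t).
  apply/(exact_dmap charF); split.
    have [_ [VD VZ]] := Vmod_subspace F m n K.+1.
    by apply: VD; [exact: vK | rewrite -scaleN1r; exact: VZ (TV _ Tt)].
  exact: etrans (linB _ _ _) (etrans (congr1 (fun x => dmap v - x) (esym E)) (subrr _)).
by rewrite -(subrK t v); apply: TD; [exact: IT | exact: Tt].
Qed.


Lemma sum_natr_scale (V : lmodType F) (J : finType) (f : J -> nat) (w : V) :
  (\sum_j f j)%N%:R *: w = \sum_j (f j)%:R *: w.
Proof. by rewrite natr_sum scaler_suml. Qed.

Lemma scale_succ_inj (V : lmodType F) k (w : V) : k%:R *: w = k.+1%:R *: w -> w = 0.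
Proof. by rewrite -[k.+1%:R]natr1 scalerDl scale1r -[LHS]addr0 => /addrI. Qed.

(* An isomorphism maps the vectors killed by all [d/dx_i] and [D_t] to such vectors,
   and the Euler operator acts on those by k on one side and by k + 1 on the other. *)
Lemma Lmod_not_iso K : ~ mod_iso F m n (Lmod K.+1) (Lmod K.+2).
Proof.
move=> [phi [[phiD [phiZ [phiT phiX]]] [phi_inj _]]].
set v0 := mono (one, spow s K.+1).
have vk := okvalid_spow K.+1.
have Iv0 : Lmod K.+1 v0.
  apply/(Lmod_Imd charF s_odd); apply: Imd_const => //; exact: odeg_spow.
have L0 : Lmod K.+1 0.
  by apply/(Lmod_Imd charF s_odd); have [[]] := Imd_submod m n charF K.
have p0 : phi 0 = 0 by have := phiZ 0 0 L0; rewrite scale0r => ->; rewrite scale0r.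
set w := phi v0.
have wV : Vmod K.+2 w.
  have /(Lmod_Imd charF s_odd)[u [uK E]] := phiT _ Iv0.
  by rewrite /w E; exact: Vmod_dmap.
have w0 : w != 0.
  by apply/eqP => E; apply: (@mono_neq0 F m n (one, spow s K.+1)); apply: phi_inj; rewrite ?p0.
have wv := Vmod_valid wV.
have aw a : act (Wvec one a) w = 0.
  rewrite -phiX // act_mono // actsum_r1 tens0l ?pd_r1 //.
have wc key : key \in msupp w -> key.1 = one.
  move=> kw; apply/eqP; apply: contraT => /(act_one_neq0 charF wv kw)[a].
  by rewrite aw eqxx.
have Ew b : act (Wvec (var b) b) w = (spow s K.+1 b)%:R *: w.
  have rb : rcount one b = 0%N by apply/eqP; rewrite -(pd_coef_eq0 b one charF) pd_r1.
  have E : act (Wvec (var b) b) v0 = (spow s K.+1 b)%:R *: v0.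
    rewrite /v0; apply: (etrans (act_mono F (var b) b one vk)).
    by rewrite (actsum_var_diag mono b one vk) rb.
  exact: etrans (esym (phiX _ _ Iv0)) (etrans (congr1 phi E) (phiZ _ _ Iv0)).
have odegs : (\sum_b spow s K.+1 b = K.+1)%N := odeg_spow K.+1.
have r0 : rdeg one = 0%N by rewrite /rdeg cards0 big1 // => i _; rewrite ffunE.
have Elin : lin F m n (fun key => weight F key *: mono key) w = K.+2%:R *: w.
  apply: (etrans _ (congr1 _ (lin_mono w))); rewrite /lin scaler_sumr.
  apply: eq_big_seq => key kw; rewrite !scalerA mulrC /weight (wc _ kw) r0.
  by have [_ ->] := wV _ kw.
have : K.+1%:R *: w = K.+2%:R *: w.
  apply: (etrans _ (etrans (euler wv) Elin)).
  transitivity (\sum_b (spow s K.+1 b)%:R *: w).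
    by rewrite -{1}odegs; exact: sum_natr_scale.
  by apply: eq_bigr => b _; exact: esym (Ew b).
by move/scale_succ_inj/eqP; rewrite (negbTE w0).
Qed.

End CompositionFactors.

(** Submodules between Im d_(k-1) and V(omega_k) stand for those of the quotient, and a surjective
    module map with kernel Im d_(k-1) for the isomorphism. By Jordan-Hölder the series determines
    the composition factors. *)
Theorem theorem4p3 (F : closedFieldType) (m n : nat) :
  [pchar F] =i pred0 -> (0 < m)%N -> (0 < n)%N ->
  (* (1) *)
  (forall k : nat,
     (forall v, Imd F m n k v <-> Kerd F m n k.+1 v) /\
     simple_submod F m n (Imd F m n k) /\
     mod_iso F m n (Imd F m n k) (Lmod F m n k.+1)) /\
  (* (2) composition series 0 < Im d_{k-1} < V(omega_k) *)
  (forall k : nat, (1 <= k)%N ->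
     is_submod F m n (Vmod F m n k) /\
     (* the submodule Im d_{k-1} : simple, isomorphic to L(omega_k) *)
     (forall v, Imd F m n k.-1 v -> Vmod F m n k v) /\
     simple_submod F m n (Imd F m n k.-1) /\
     mod_iso F m n (Imd F m n k.-1) (Lmod F m n k) /\
     (* the quotient V(omega_k)/Im d_{k-1} is nonzero and simple ... *)
     (exists v, Vmod F m n k v /\ ~ Imd F m n k.-1 v) /\
     (forall T, is_submod F m n T ->
        (forall v, Imd F m n k.-1 v -> T v) -> (forall v, T v -> Vmod F m n k v) ->
        (forall v, T v -> Imd F m n k.-1 v) \/ (forall v, Vmod F m n k v -> T v)) /\
     (* ... and isomorphic to Im d_k (a surjective module map with kernel
        Im d_{k-1}), which is isomorphic to L(omega_{k+1}) *)
     (exists phi, is_modhom F m n (Vmod F m n k) (Imd F m n k) phi /\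
        (forall w, Imd F m n k w -> exists v, Vmod F m n k v /\ phi v = w) /\
        (forall v, Vmod F m n k v -> (phi v = 0 <-> Imd F m n k.-1 v))) /\
     mod_iso F m n (Imd F m n k) (Lmod F m n k.+1) /\
     (* multiplicity one: the two factors are non-isomorphic *)
     ~ mod_iso F m n (Lmod F m n k) (Lmod F m n k.+1)).
Proof.
move=> charF _ n0.
have [s s_odd] : exists s, oddi m n s.
  by exists (odI m n (Ordinal n0)); exact: oddi_odI.
split=> [K|[//|K] _ /=].
  split; first exact: exact_dmap.
  by split; [exact: (Imd_simple charF s_odd K) | exact: (Imd_iso_Lmod charF s_odd K)].
split; first exact: Vmod_submod.
split; first by move=> v /(exact_dmap charF)[].
split; first exact: (Imd_simple charF s_odd K).
split; first exact: (Imd_iso_Lmod charF s_odd K).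
split.
  (* A vector that is not closed, hence not in the image: y_s (x) e_s^(K+1), of form degree k = K +
     1. *)
  exists (mono F (var s, spow s K.+1)); split.
    by apply: Vmod_mono; [exact: okvalid_spow | exact: odeg_spow].
  move=> /(exact_dmap charF)[_ E].
  by move/eqP: (dmap_var_neq0 F s_odd K.+1); apply.
split; first exact: (quotient_simple charF s_odd).
split.
  exists (dmap F m n); split; first exact: dmap_modhom.
  split=> [w [v [vK ->]]|v vK]; first by exists v.
  split=> [E|/(exact_dmap charF)[]//].
  by apply/(exact_dmap charF).
split; first exact: (Imd_iso_Lmod charF s_odd K.+1).
exact: (Lmod_not_iso charF s_odd).
Qed.
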